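(* Suppose that $m$ is a non-rational Herglotz--Nevanlinna function with measure $\rho$ in its integral representation and let $K\in\mathbb{N}_0$. Then the moments of the measure $\rho$ exist up to order $2K$ if and only if there is a Herglotz--Nevanlinna function $\tilde m$, an integer $N\in\mathbb{N}$, non-negative constants $\upsilon_0,\ldots,\upsilon_N$, real constants $\omega_0,\ldots,\omega_{N-1}$ and positive constants $l_1,\ldots,l_N$ with $\upsilon_n+|\omega_n|>0$ for all $n\in\{1,\ldots,N-1\}$ and $$N-1+\#\{n\in\{1,\ldots,N\}\,|\,\upsilon_n\neq0\}\geq K$$ such that the function $m$ admits the continued fraction expansion $$m(z) = \upsilon_0 z + \omega_0 + \cfrac{1}{-l_{1}z + \cfrac{1}{\upsilon_1 z + \omega_1 + \cfrac{1}{ \;\ddots\; + \cfrac{1}{-l_{N} z + \cfrac{1}{\upsilon_N z + \tilde{m}(z)}}}}}\,, \quad z\in\mathbb{C}\backslash\mathbb{R}.$$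
   Context: A Herglotz--Nevanlinna function is an analytic function $m$ on $\mathbb{C}\backslash\mathbb{R}$ which maps the upper half-plane into the closure of the upper half-plane and satisfies $m(z)^\ast=m(z^\ast)$. It has a unique integral representation $$m(z)= a + bz + \int_{\mathbb{R}} \Big(\frac{1}{\lambda-z} - \frac{\lambda}{1+\lambda^2}\Big)d\rho(\lambda),\quad z\in\mathbb{C}\backslash\mathbb{R},$$ with $a\in\mathbb{R}$, $b\geq0$ and a non-negative Borel measure $\rho$ on $\mathbb{R}$ with $\int_{\mathbb{R}}(1+\lambda^2)^{-1}d\rho(\lambda)<\infty$. The moments of $\rho$ exist up to order $k$ if $\int_{\mathbb{R}}|\lambda|^i\,d\rho(\lambda)<\infty$ for all $i\in\{0,\dots,k\}$. For $N=1$ the continued fraction reads $m(z)=\upsilon_0z+\omega_0+\dfrac{1}{-l_1z+\frac{1}{\upsilon_1z+\tilde m(z)}}$. *)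

(* Defs.v *)
From HB Require Import structures.
From mathcomp Require Import all_boot all_order all_algebra.
From mathcomp Require Import complex.
From mathcomp Require Import all_classical all_reals all_analysis.

Set Implicit Arguments.
Unset Strict Implicit.
Unset Printing Implicit Defensive.

Import Order.TTheory GRing.Theory Num.Theory.
Import numFieldNormedType.Exports.

Local Open Scope classical_set_scope.
Local Open Scope ring_scope.
Local Open Scope complex_scope.

(* Functions on C \ R are represented by total functions R[i] -> R[i]; only
   their values at points z with Im z != 0 are ever used. *)
Definition nonreal (R : realType) (z : R[i]) : Prop := complex.Im z != 0.

(* With R[i]^o seen as a normed space over the field R[i], derivability in the
   direction 1 is complex differentiability. *)
Definition herglotz_nevanlinna (R : realType) (m : R[i] -> R[i]) : Prop :=
  [/\ forall z : R[i], nonreal z -> derivable (m : R[i]^o -> R[i]^o) z 1,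
      forall z : R[i], 0 < complex.Im z -> 0 <= complex.Im (m z)
    & forall z : R[i], nonreal z -> conjc (m z) = m (conjc z)].

(* Agreement with one and the same quotient of polynomials on both
   half-planes. *)
Definition rational_off_real (R : realType) (m : R[i] -> R[i]) : Prop :=
  exists p q : {poly R[i]},
    forall z : R[i], nonreal z -> q.[z] != 0 /\ m z = p.[z] / q.[z].

Definition complex_integral (R : realType)
    (rho : {measure set (measurableTypeR R) -> \bar R}) (f : R -> R[i]) : R[i] :=
  Rintegral rho setT (fun t => complex.Re (f t)) +i*
  Rintegral rho setT (fun t => complex.Im (f t)).

Definition herglotz_measure (R : realType) (m : R[i] -> R[i])
    (rho : {measure set (measurableTypeR R) -> \bar R}) : Prop :=
  (\int[rho]_(t in setT) ((1 + t ^+ 2)^-1)%:E < +oo)%E /\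
  exists a b : R, 0 <= b /\
    forall z : R[i], nonreal z ->
      m z = a%:C + b%:C * z +
        complex_integral rho (fun t : R => (t%:C - z)^-1 - (t / (1 + t ^+ 2))%:C).

Definition moments_upto (R : realType)
    (rho : {measure set (measurableTypeR R) -> \bar R}) (k : nat) : Prop :=
  forall i : nat, (i <= k)%N ->
    (\int[rho]_(t in setT) (`|t| ^+ i)%:E < +oo)%E.

(* The last d levels of the continued fraction, starting at index n:
     upsilon_n z + omega_n + 1 / (- l_(n+1) z + 1 / (...)),
   ending with upsilon_(n+d) z + w. If w is the value at z of a
   Herglotz-Nevanlinna function that is not a real constant, then the
   denominators do not vanish (z nonreal, l > 0, upsilon >= 0): 0^-1 = 0 plays
   no role. *)
Fixpoint contfrac (R : realType) (upsilon omega l : nat -> R) (z w : R[i])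
    (n d : nat) : R[i] :=
  match d with
  | 0%N => (upsilon n)%:C * z + w
  | d'.+1 =>
      (upsilon n)%:C * z + (omega n)%:C +
      (- (l n.+1)%:C * z + (contfrac upsilon omega l z w n.+1 d')^-1)^-1
  end.

(* Main.v *)
(* Everything is read off the behaviour of m on the imaginary axis. The moments
   of rho exist up to order 2K iff
     m(iy) = b iy + c + p(1/(iy)) + O(y^-(2K+1)),  y -> +oo,
   for some real polynomial p without constant term and real b, c; this class
   of expansions is stable under the elementary steps of the continued fraction.

   From moments to the fraction: instead of the integral representation of the
   successive remainders, one carries along the positive definiteness of the
   kernel (f(z) - conj f(w))/(z - conj w) at all finite families of points, which
   follows for m from the representation by a Gram matrix. It is obviously kept
   by f |-> -1/f, and also by f |-> f - lz when f(iy) = l iy + O(1): add the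
   point iy to the family, with weight minus the sum of the other weights, and
   let y -> +oo. A function that vanishes at a nonreal point vanishes
   identically by the 2-point (Schwarz-Pick) inequality, hence non-rationality
   keeps all denominators nonzero.

   From the fraction to moments: for J_k(y) = int t^2k/(t^2 + y^2) drho one has
   Im m(iy) = y (b + J_0(y)) and J_(k+1)(y) = int t^2k drho - y^2 J_k(y). An
   expansion of J_k in powers of y^-2 has no constant term as J_k(y) -> 0, so
   y^2 J_k(y) is bounded, and monotone convergence gives the next moment. *)
Require Import Defs.
From HB Require Import structures.
From mathcomp Require Import all_boot all_order all_algebra.
From mathcomp Require Import ring lra.
From mathcomp Require Import complex.
From mathcomp Require Import all_classical all_reals all_analysis.
From mathcomp Require Import measurable_realfun.

Set Implicit Arguments.
Unset Strict Implicit.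
Unset Printing Implicit Defensive.

Import Order.TTheory GRing.Theory Num.Theory.
Import numFieldNormedType.Exports.

Local Open Scope classical_set_scope.
Local Open Scope ring_scope.
Local Open Scope complex_scope.

(** * Asymptotic expansions along the imaginary axis *)

Import Normc.

Section Asymptotics.
Variable R : realType.
Implicit Types (g h : R -> R[i]) (c y C : R) (n m : nat) (p q : {poly R}).

Definition iy y : R[i] := 0 +i* y.

Lemma iy_neq0 y : 0 < y -> iy y != 0.
Proof. by move=> y0; rewrite eq_complex /= eqxx /= gt_eqF. Qed.

Lemma normc_ge0 (z : R[i]) : 0 <= normc z.
Proof. by case: z => a b; exact: sqrtr_ge0. Qed.

Lemma normc_iy y : 0 < y -> normc (iy y) = y.
Proof. by move=> y0; rewrite /= expr0n /= add0r sqrtr_sqr gtr0_norm. Qed.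

Lemma normc_real c : normc c%:C = `|c|.
Proof. by rewrite /= expr0n /= addr0 sqrtr_sqr. Qed.

Lemma normcX (z : R[i]) n : normc (z ^+ n) = normc z ^+ n.
Proof.
by elim: n => [|n IH]; rewrite ?expr0 ?normc1 // !exprS normcM IH.
Qed.

Definition decay n g := exists2 C, 0 <= C &
  \forall y \near +oo, normc (g y) <= C / y ^+ n.

(* g(y) = p(1/(iy)) + O(y^-n) with a REAL polynomial p; the constant term c
   carries no information when n = 0. *)
Definition asym n c g := exists2 p, p.[0] = c &
  decay n (fun y => g y - (map_poly (real_complex R) p).[(iy y)^-1]).

Lemma near_ge1 : \forall y \near +oo, (1 : R) <= y.
Proof. by apply: nbhs_pinfty_ge; rewrite realE ler01. Qed.

Lemma decay_eq_near n g h : (\forall y \near +oo, g y = h y) -> decay n g -> decay n h.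
Proof.
move=> gh [C C0 Cg]; exists C => //.
by apply: filterS2 gh Cg => y ->.
Qed.

Lemma decay_eq n g h : (forall y, 0 < y -> g y = h y) -> decay n g -> decay n h.
Proof.
move=> gh; apply: decay_eq_near; apply: filterS near_ge1 => y y1.
by apply: gh; exact: lt_le_trans y1.
Qed.

Lemma asym_eq n c g h : (forall y, 0 < y -> g y = h y) -> asym n c g -> asym n c h.
Proof.
move=> gh [p pc dp]; exists p => //; apply: decay_eq dp => y y0.
by rewrite gh.
Qed.

Lemma decay_le n m g : (n <= m)%N -> decay m g -> decay n g.
Proof.
move=> nm [C C0 Cg]; exists C => //.
near=> y; have y1 : 1 <= y by near: y; exact: near_ge1.
apply: (@le_trans _ _ (C / y ^+ m)); first by near: y.
rewrite ler_wpM2l // lef_pV2 ?posrE ?exprn_gt0 ?(lt_le_trans ltr01)//.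
by rewrite ler_weXn2l.
Unshelve. all: by end_near. Qed.

Lemma decayD n g h : decay n g -> decay n h -> decay n (fun y => g y + h y).
Proof.
move=> [C C0 Cg] [D D0 Dh]; exists (C + D); first exact: addr_ge0.
near=> y; rewrite mulrDl; apply: le_trans (le_normcD _ _) _.
by apply: lerD; near: y.
Unshelve. all: by end_near. Qed.

Lemma decayM n m g h : decay n g -> decay m h -> decay (n + m) (fun y => g y * h y).
Proof.
move=> [C C0 Cg] [D D0 Dh]; exists (C * D); first exact: mulr_ge0.
near=> y; rewrite normcM exprD invfM mulrACA.
by apply: ler_pM; rewrite ?normc_ge0 //; near: y.
Unshelve. all: by end_near. Qed.

Lemma decayMr n g h : decay n g -> decay 0 h -> decay n (fun y => g y * h y).
Proof. by move=> dg dh; rewrite -[n]addn0; exact: decayM. Qed.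

Lemma decay_bound C g : 0 <= C -> (forall y, 1 <= y -> normc (g y) <= C) -> decay 0 g.
Proof.
move=> C0 H; exists C => //; near=> y; rewrite expr0 divr1; apply: H.
by near: y; exact: near_ge1.
Unshelve. all: by end_near. Qed.

Lemma decay_cst (a : R[i]) : decay 0 (fun=> a).
Proof. by apply: (@decay_bound (normc a)) => //; exact: normc_ge0. Qed.

Lemma decay_iyV : decay 1 (fun y => (iy y)^-1).
Proof.
exists 1 => //; apply: filterS near_ge1 => y y1.
by rewrite normcV normc_iy ?div1r // (lt_le_trans ltr01).
Qed.

Lemma decay_iyVX n : decay n (fun y => (iy y)^-1 ^+ n).
Proof.
elim: n => [|n IH]; first exact: decay_cst.
by apply: decay_eq (decayM decay_iyV IH) => y _; rewrite exprS.
Qed.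

Lemma decay_horner (p : {poly R[i]}) : decay 0 (fun y => p.[(iy y)^-1]).
Proof.
elim/poly_ind: p => [|p a IH].
  by apply: decay_eq (decay_cst 0) => y _; rewrite horner0.
apply: decay_eq (decayD (decayM IH (decay_le _ decay_iyV)) (decay_cst a)) => // y _.
by rewrite hornerMXaddC.
Qed.

Lemma asym_le n m c g : (n <= m)%N -> asym m c g -> asym n c g.
Proof. by move=> nm [p pc dp]; exists p => //; exact: decay_le dp. Qed.

Lemma decay_asym n g : decay n g -> asym n 0 g.
Proof.
move=> d; exists 0; first by rewrite horner0.
by apply: decay_eq d => y _; rewrite rmorph0 horner0 subr0.
Qed.

Lemma asym_decay0 n c g : asym n c g -> decay 0 g.
Proof.
move=> [p _ dp]; apply: decay_eq (decayD (decay_le (leq0n _) dp)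
  (decay_horner (map_poly (real_complex R) p))).
by move=> y _ /=; rewrite subrK.
Qed.

Lemma poly_root0 p : p.[0] = 0 -> exists q, p = q * 'X.
Proof.
move=> p0; have : root p 0 by apply/rootP.
by move=> /factor_theorem[q ->]; exists q; rewrite subr0.
Qed.

Lemma asym_decay1 n g : asym n.+1 0 g -> decay 1 g.
Proof.
move=> [p /poly_root0[q ->] dp].
apply: decay_eq (decayD (decay_le _ dp) (decayM (decay_horner (map_poly (real_complex R) q)) decay_iyV)) => //.
by move=> y _; rewrite rmorphM /= map_polyX hornerMX subrK.
Qed.

Lemma asymD n c d g h : asym n c g -> asym n d h -> asym n (c + d) (fun y => g y + h y).
Proof.
move=> [p <- dp] [q <- dq]; exists (p + q); first by rewrite hornerD.
by apply: decay_eq (decayD dp dq) => y _; rewrite rmorphD /= hornerD opprD addrACA.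
Qed.

Lemma asymM n c d g h : asym n c g -> asym n d h -> asym n (c * d) (fun y => g y * h y).
Proof.
move=> ag; have [p <- dp] := ag; move=> [q <- dq].
exists (p * q); first by rewrite hornerM.
have := decayD (decayM (asym_decay0 ag) dq) (decayMr dp (decay_horner (map_poly (real_complex R) q))).
apply: decay_eq => y _; rewrite rmorphM hornerM /=; ring.
Qed.

Lemma asym_cst n c : asym n c (fun=> c%:C).
Proof.
exists c%:P; first by rewrite hornerC.
have := decayMr (decay_iyVX n) (decay_cst 0).
by apply: decay_eq => y _; rewrite map_polyC hornerC subrr mulr0.
Qed.

Lemma asymN n c g : asym n c g -> asym n (- c) (fun y => - g y).
Proof.
move=> ag; have := asymM (asym_cst n (-1)) ag; rewrite mulN1r.
by apply: asym_eq => y _; rewrite rmorphN1 mulN1r.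
Qed.

Lemma asym_divz n c g : asym n c g -> asym n.+1 0 (fun y => g y / iy y).
Proof.
move=> [p _ dp]; exists (p * 'X); first by rewrite hornerMX mulr0.
have := decayM dp decay_iyV; rewrite addn1; apply: decay_eq => y _.
by rewrite rmorphM /= map_polyX hornerMX mulrBl.
Qed.

(** Without a constant term p = q X, and the factor X cancels iy at the cost of one order. The new
    constant term is the former linear coefficient of p. *)
Lemma asym_mulz n g : asym n.+1 0 g -> exists c, asym n c (fun y => g y * iy y).
Proof.
move=> [p /poly_root0[q ->] [C C0 Cg]]; exists q.[0]; exists q => //.
exists C => //; near=> y.
have y0 : 0 < y by apply: (@lt_le_trans _ _ 1) => //; near: y; exact: near_ge1.
have -> : g y * iy y - (map_poly (real_complex R) q).[(iy y)^-1] =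
   (g y - (map_poly (real_complex R) (q * 'X)).[(iy y)^-1]) * iy y.
  by rewrite rmorphM /= map_polyX hornerMX mulrBl divfK ?iy_neq0.
rewrite normcM normc_iy // -ler_pdivlMr //.
have -> : C / y ^+ n / y = C / y ^+ n.+1 by rewrite exprSr invfM mulrA.
by near: y.
Unshelve. all: by end_near. Qed.

(** The inverse power series of p truncated at order n, built one coefficient at a time: a multiple
    of [p] clears the constant term of the remainder [r], which frees one more factor X. *)
Lemma poly_inv_mod p n : p.[0] != 0 ->
  exists q r : {poly R}, p * q = 1 + r * 'X^n.
Proof.
move=> p0; elim: n => [|n [q [r e]]].
  by exists 0, (-1); rewrite mulr0 expr0 mulr1 subrr.
have [s es] : exists s, r - (r.[0] / p.[0]) *: p = s * 'X.
  by apply: poly_root0; rewrite hornerD hornerN hornerZ divfK // subrr.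
exists (q - (r.[0] / p.[0]) *: 'X^n), s.
rewrite mulrBr e -scalerAr -addrA; congr (_ + _).
by rewrite exprS mulrA -es mulrBl -scalerAl.
Qed.

Lemma asym_near_ge n c g : asym n.+1 c g ->
  \forall y \near +oo, `|c| / 2 <= normc (g y).
Proof.
have [->|c0] := eqVneq c 0 => ag.
  by near=> y; rewrite normr0 mul0r normc_ge0.
have /asym_decay1[C C0 Cg] : asym n.+1 0 (fun y => g y - c%:C).
  rewrite -(subrr c); apply: asymD => //.
  by apply: asym_eq (asym_cst _ (- c)) => y _; rewrite rmorphN.
have c0' : 0 < `|c| by rewrite normr_gt0.
near=> y.
have y0 : 0 < y by apply: (@lt_le_trans _ _ 1) => //; near: y; exact: near_ge1.
have gC : normc (g y - c%:C) <= C / y by rewrite -(expr1 y); near: y.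
have yC : C / y <= `|c| / 2.
  rewrite ler_pdivrMr // -ler_pdivrMl; last by rewrite divr_gt0.
  by near: y; apply: nbhs_pinfty_ge; exact: num_real.
have : `|c| <= normc (g y) + normc (g y - c%:C).
  rewrite -normc_real -{1}(subKr (g y) c%:C).
  by apply: le_trans (le_normcD _ _) _; rewrite normcN.
lra.
Unshelve. all: by end_near. Qed.

Lemma decayV n c g : c != 0 -> asym n.+1 c g -> decay 0 (fun y => (g y)^-1).
Proof.
move=> c0 /asym_near_ge ag.
have c0' : 0 < `|c| / 2 by rewrite divr_gt0 ?normr_gt0.
exists (`|c| / 2)^-1; first by rewrite invr_ge0 ltW.
near=> y; rewrite expr0 divr1 normcV.
have gc : `|c| / 2 <= normc (g y) by near: y.
by rewrite lef_pV2 ?posrE // (lt_le_trans c0').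
Unshelve. all: by end_near. Qed.

(** With [p * q = 1 + r * 'X^n.+1] and all polynomials taken at 1/(iy), 1/g - q =
    (1/g)(-r/(iy)^(n+1) - (g - p) q), where 1/g is bounded since c is nonzero. *)
Lemma asymV n c g : c != 0 -> asym n.+1 c g -> asym n.+1 c^-1 (fun y => (g y)^-1).
Proof.
move=> c0 ag; have dg := decayV c0 ag; have [p pc dp] := ag.
have [q [r e]] := @poly_inv_mod p n.+1 ltac:(by rewrite pc).
exists q.
  have := congr1 (fun u => u.[0]) e.
  rewrite /= hornerD !hornerM hornerXn expr0n mulr0 addr0 pc hornerC => e1.
  by apply: (mulfI c0); rewrite divff.
pose E p := map_poly (real_complex R) p.
have := decayM dg (decayD
     (decayM (decay_horner (E (- r))) (decay_iyVX n.+1))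
     (decayMr dp (decay_horner (E (- q))))).
apply: decay_eq_near; near=> y.
have g0 : g y != 0.
  apply: contraTneq (_ : `|c| / 2 <= normc (g y)) => [->|]; last first.
    by near: y; exact: asym_near_ge ag.
  by rewrite normc0 -ltNge divr_gt0 ?normr_gt0.
have : (E (p * q)).[(iy y)^-1] = 1 + (E r).[(iy y)^-1] * (iy y)^-1 ^+ n.+1.
  by rewrite e /E rmorphD rmorphM rmorph1 /= map_polyXn hornerD hornerC hornerM hornerXn.
rewrite /E rmorphM hornerM !rmorphN !hornerN /= => e1.
rewrite mulrN mulNr mulrBl opprB addrA [_ + _ * _]addrC.
apply: (mulfI g0); rewrite mulrA mulrV ?unitfE // mul1r mulrBr mulrV ?unitfE //.
by rewrite e1; ring.
Unshelve. all: by end_near. Qed.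

End Asymptotics.

(** * Continued fractions *)

Section ContinuedFraction.
Variable R : realType.
Implicit Types (l c : R) (z w : R[i]) (upsilon omega ell : nat -> R).

Lemma Im_inv_le0 z : 0 <= complex.Im z -> complex.Im z^-1 <= 0.
Proof.
case: z => a b /= b0; rewrite oppr_le0 divr_ge0 ?addr_ge0 ?sqr_ge0 //.
Qed.

Lemma Im_realM (c : R) z : complex.Im (c%:C * z) = c * complex.Im z.
Proof. by case: z => a b /=; rewrite mul0r addr0. Qed.

Lemma ImD z w : complex.Im (z + w) = complex.Im z + complex.Im w.
Proof. by case: z w => ? ? []. Qed.

Lemma ReD z w : complex.Re (z + w) = complex.Re z + complex.Re w.
Proof. by case: z w => ? ? []. Qed.

Lemma ImN z : complex.Im (- z) = - complex.Im z.
Proof. by case: z. Qed.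

Lemma normRe_le_normc z : `|complex.Re z| <= normc z.
Proof. by rewrite -lecR; exact: normc_ge_Re. Qed.

Lemma normIm_le_normc z : `|complex.Im z| <= normc z.
Proof.
case: z => a b; rewrite -sqrtr_sqr ler_wsqrtr //= lerDr; exact: sqr_ge0.
Qed.

Lemma Im_le_normc z : complex.Im z <= normc z.
Proof. exact: le_trans (ler_norm _) (normIm_le_normc z). Qed.

Lemma decay_inv_Im (c : R) (G : R -> R[i]) : 0 < c ->
  (forall y, 0 < y -> c * y <= complex.Im (G y)) -> decay 1 (fun y => (G y)^-1).
Proof.
move=> c0 H; exists c^-1; first by rewrite invr_ge0 ltW.
apply: filterS (@near_ge1 R) => y /(lt_le_trans ltr01) y0.
rewrite normcV -invfM lef_pV2 ?posrE ?mulr_gt0 //.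
  exact: le_trans (H y y0) (Im_le_normc _).
by apply: lt_le_trans (le_trans (H y y0) (Im_le_normc _)); rewrite mulr_gt0.
Qed.

(** Pulling out iy turns the fraction into (1/iy) / (-l + 1/(iy G)), whose denominator has the
    nonzero constant term -l and can be inverted by [asymV]. *)
Lemma asym_frac n (l : R) (G : R -> R[i]) : 0 < l ->
  asym n.+1 0 (fun y => (iy y * G y)^-1) ->
  asym n.+2 0 (fun y => (- l%:C * iy y + (G y)^-1)^-1).
Proof.
move=> l0 aG; have := asymD (asym_cst n.+1 (- l)) aG; rewrite addr0.
move=> /asymV; rewrite oppr_eq0 gt_eqF // => /(_ isT)/asym_divz.
apply: asym_eq => y /iy_neq0 y0.
rewrite -invfM rmorphN; congr (_^-1).
by rewrite mulrDl invfM mulrAC mulVf // mul1r.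
Qed.

(** Induction from the innermost level outwards. The last l alone gives order 1; every further level
    adds two to the order, and every nonzero upsilon another two, since 1/(iy G) then carries a
    factor (iy)^-2. *)
Lemma asym_contfrac_tail (mt : R[i] -> R[i]) upsilon omega ell d n :
  (forall z : R[i], 0 < complex.Im z -> 0 <= complex.Im (mt z)) ->
  (forall i, (n <= i <= n + d)%N -> 0 <= upsilon i) ->
  (forall i, (n <= i <= n + d)%N -> 0 < ell i) ->
  (forall i, (n <= i < n + d)%N -> 0 < upsilon i + `|omega i|) ->
  asym (2 * (d + count (fun i => upsilon i != 0) (iota n d.+1))).+1 0
   (fun y => (- (ell n)%:C * iy y +
     (contfrac upsilon omega ell (iy y) (mt (iy y)) n d)^-1)^-1).
Proof.
move=> mt0; elim: d n => [|d IH] n u0 l0 uo.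
  have ln : 0 < ell n by apply: l0; rewrite leqnn leq_addr.
  have un : 0 <= upsilon n by apply: u0; rewrite leqnn leq_addr.
  have imt y : 0 < y -> 0 <= complex.Im (mt (iy y)) by move=> y0; apply: mt0.
  rewrite /= addn0 add0n; case: eqVneq => [->|un0] /=.
    apply: decay_asym.
    (* The minus sign brings the imaginary part above [ell n * y], since 1/mt has non-positive
       imaginary part. This covers mt = 0, where the inverse is 0 by convention. *)
    have : decay 1 (fun y => (- (- (ell n)%:C * iy y + (mt (iy y))^-1))^-1).
      apply: (decay_inv_Im ln) => y y0.
      rewrite ImN ImD mulNr ImN Im_realM /= opprD opprK lerDl oppr_ge0.
      by apply: Im_inv_le0; exact: imt.
    move=> /(decayM (decay_cst (- 1)%:C)); rewrite add0n; apply: decay_eq => y _.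
    by rewrite invrN rmorphN1 mulN1r opprK mul0r add0r.
  apply: asym_frac => //; apply: decay_asym.
  have : decay 1 (fun y => ((upsilon n)%:C * iy y + mt (iy y))^-1).
    apply: (@decay_inv_Im (upsilon n)) => [|y y0]; first by rewrite lt_neqAle eq_sym un0.
    by rewrite ImD Im_realM /= lerDl imt.
  move=> /(decayM (@decay_iyV R)); apply: decay_eq => y _.
  by rewrite -invfM.
have ln : 0 < ell n by apply: l0; rewrite leqnn leq_addr.
have un : 0 <= upsilon n by apply: u0; rewrite leqnn leq_addr.
have := IH n.+1.
set k := (d + _)%N; set M := fun y => (_ + _)^-1 => aM.
have {}aM : asym (2 * k).+1 0 M.
  apply: aM => i /andP[ni id].
  - by apply: u0; rewrite (ltnW ni) /= addnS -addSn.
  - by apply: l0; rewrite (ltnW ni) /= addnS -addSn.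
  - by apply: uo; rewrite (ltnW ni) /= addnS -addSn.
have -> : (d.+1 + count (fun i => upsilon i != 0%R) (iota n d.+2) =
   (upsilon n != 0%R) + k.+1)%N.
  by rewrite /k [iota n _]/= [count _ _]/= addSn addnCA addnS.
have aw m : asym m (omega n) (fun=> (omega n)%:C) by exact: asym_cst.
have unC : upsilon n != 0 -> asym (2 * k).+2 (upsilon n)
    (fun y => ((upsilon n)%:C * iy y + (omega n)%:C + M y) / iy y).
  move=> u0'; have := asymD (asymD (asym_cst (2 * k).+2 (upsilon n)) (asym_divz (aw _))) (asym_divz aM).
  rewrite !addr0; apply: asym_eq => y /iy_neq0 y0.
  by rewrite !mulrDl mulfK.
case: eqVneq => [u00|un0]; rewrite ?add0n ?add1n !mulnS !addSn !add0n /=; apply: asym_frac => //.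
  (* Here [omega n] is the constant term of the level, and the side condition on upsilon and omega
     makes it invertible. *)
  have wn0 : omega n != 0.
    have : 0 < upsilon n + `|omega n| by apply: uo; rewrite leqnn addnS ltnS leq_addr.
    by rewrite u00 add0r normr_gt0.
  have := asymD (aw _) aM; rewrite addr0 => /(asymV wn0)/asym_divz.
  by apply: asym_eq => y _; rewrite u00 mul0r add0r invfM mulrC.
have := asym_divz (asym_divz (asymV un0 (unC un0))).
apply: asym_eq => y /iy_neq0 y0.
by rewrite invfM invrK mulfK // invfM mulrC.
Qed.

Definition fcons (x : R) (s : nat -> R) (n : nat) : R := if n is n'.+1 then s n' else x.

Lemma contfrac_fcons (u w l : R) upsilon omega ell (z v : R[i]) n d :
  contfrac (fcons u upsilon) (fcons w omega) (fcons l ell) z v n.+1 d =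
  contfrac upsilon omega ell z v n d.
Proof. by elim: d n => [|d IH] n //=; rewrite IH. Qed.

Lemma count_fcons (x : R) (s : nat -> R) n :
  count (fun i => fcons x s i != 0%R) (iota 1 n) = count (fun i => s i != 0%R) (iota 0 n).
Proof. by rewrite (iotaDl 1 0) count_map; apply: eq_count. Qed.

Lemma count_fcons0 (x : R) (s : nat -> R) n :
  count (fun i => fcons x s i != 0%R) (iota 0 n.+1) =
  ((x != 0%R) + count (fun i => s i != 0%R) (iota 0 n))%N.
Proof. by rewrite -(count_fcons x s n); reflexivity. Qed.

(* upsilon, omega and ell are shifted: their entries of index n are the
   constants of index n + 1 of the continued fraction. *)
Definition tail_expansion (k : nat) (f : R[i] -> R[i]) : Prop :=
  exists (mt : R[i] -> R[i]) (d : nat) (upsilon omega ell : nat -> R),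
  [/\ herglotz_nevanlinna mt,
      forall n, (n <= d)%N -> 0 <= upsilon n,
      forall n, (n <= d)%N -> 0 < ell n,
      forall n, (n < d)%N -> 0 < upsilon n + `|omega n| &
      (k <= d + count (fun n => upsilon n != 0%R) (iota 0 d.+1))%N /\
      forall z : R[i], nonreal z -> f z = (- (ell 0%N)%:C * z +
         (contfrac upsilon omega ell z (mt z) 0 d)^-1)^-1].

Lemma tail_expansion_cons k (f g : R[i] -> R[i]) (u w l : R) :
  tail_expansion k g -> 0 < l -> 0 <= u -> 0 < u + `|w| ->
  (forall z : R[i], nonreal z ->
     f z = (- l%:C * z + (u%:C * z + w%:C + g z)^-1)^-1) ->
  tail_expansion (k + (u != 0)).+1 f.
Proof.
move=> [mt [d [up [om [el [hmt up0 el0 uo0 [kd gE]]]]]]] l0 u0 uw0 fE.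
exists mt, d.+1, (fcons u up), (fcons w om), (fcons l el); split => //.
- by case.
- by case.
- by case.
- split; last by move=> z /[dup] /gE gz /fE ->; rewrite /= contfrac_fcons gz.
  rewrite count_fcons0 addSn ltnS addnCA addnC.
  by rewrite leq_add2l.
Qed.

Lemma tail_expansion_full k (m g : R[i] -> R[i]) (u w : R) :
  tail_expansion k g -> 0 <= u ->
  (forall z : R[i], nonreal z -> m z = u%:C * z + w%:C + g z) ->
  exists (mt : R[i] -> R[i]) (N : nat) (upsilon omega l : nat -> R),
    herglotz_nevanlinna mt /\
    (1 <= N)%N /\
    (forall n : nat, (n <= N)%N -> 0 <= upsilon n) /\
    (forall n : nat, (1 <= n <= N)%N -> 0 < l n) /\
    (forall n : nat, (1 <= n <= N.-1)%N -> 0 < upsilon n + `|omega n|) /\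
    (k <= N.-1 + count (fun n => (upsilon n != 0)%R) (iota 1 N))%N /\
    (forall z : R[i], nonreal z ->
       m z = contfrac upsilon omega l z (mt z) 0 N).
Proof.
move=> [mt [d [up [om [el [hmt up0 el0 uo0 [kd gE]]]]]]] u0 mE.
exists mt, d.+1, (fcons u up), (fcons w om), (fcons 0 el); split => //; split => //.
split; first by case.
split; first by case.
split; first by case.
split; first by rewrite [X in (_ + X)%N]count_fcons.
by move=> z /[dup] /gE gz /mE ->; rewrite /= contfrac_fcons gz.
Qed.

End ContinuedFraction.

(** * Pick functions *)

Local Arguments conjc : simpl never.

Section Pick.
Variable R : realType.
Implicit Types (f F : R[i] -> R[i]) (z w : R[i]) (s : seq (R[i] * R[i])).

(** The Nevanlinna kernel of f; on the diagonal it is Im f(z) / Im z. *)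
Definition nkernel f z w : R[i] := (f z - conjc (f w)) / (z - conjc w).

(** An entry of [s] is a pair of a coefficient and a point. *)
Definition nform f s : R[i] :=
  \sum_(a <- s) \sum_(b <- s) a.1 * conjc b.1 * nkernel f a.2 b.2.

Definition upper s := all (fun a => 0 < complex.Im a.2) s.

(** In the order of [R[i]], [0 <= nform f s] says that the form is real and non-negative. One point
    with coefficient 1 gives Im f >= 0; all families are included so that the property survives the
    removal of linear terms. *)
Definition pick_function f : Prop :=
  [/\ forall z : R[i], nonreal z -> derivable (f : R[i]^o -> R[i]^o) z 1,
      forall z : R[i], nonreal z -> conjc (f z) = f (conjc z)
    & forall s, upper s -> 0 <= nform f s].

Lemma conjB z w : conjc (z - w) = conjc z - conjc w.
Proof. exact: rmorphB. Qed.

Lemma conjN z : conjc (- z) = - conjc z.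
Proof. exact: rmorphN. Qed.

Lemma conjM z w : conjc (z * w) = conjc z * conjc w.
Proof. exact: rmorphM. Qed.

Lemma nkernel_conj f z w : conjc (nkernel f z w) = nkernel f w z.
Proof.
rewrite /nkernel conjM conjc_inv !conjB !conjcK.
by rewrite -[f w - _]opprB -[w - _]opprB invrN mulrNN.
Qed.

Lemma sub_conj_neq0 z w : 0 < complex.Im z -> 0 < complex.Im w -> z - conjc w != 0.
Proof.
case: z w => a b [c d]; rewrite /conjc /= => b0 d0; rewrite eq_complex negb_and /= opprK.
by rewrite (gt_eqF (addr_gt0 b0 d0)) orbT.
Qed.

Lemma nkernel_diag f z : 0 < complex.Im z ->
  nkernel f z z = (complex.Im (f z) / complex.Im z)%:C.
Proof.
move=> z0; apply: (mulIf (sub_conj_neq0 z0 z0)).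
rewrite /nkernel divfK ?sub_conj_neq0 //.
case: z z0 (f _) => a b /= b0 [c d]; rewrite /conjc /=.
apply/eqP; rewrite eq_complex /=; apply/andP.
by split; apply/eqP; field; rewrite gt_eqF.
Qed.

Lemma pick_Im_ge0 f z : pick_function f -> 0 < complex.Im z -> 0 <= complex.Im (f z).
Proof.
move=> [_ _ H] z0; have := H [:: (1, z)]; rewrite /upper /= andbT => /(_ z0).
rewrite /nform !big_seq1 /= conjc1 !mul1r nkernel_diag // ler0c.
by rewrite ler_pdivlMr // mul0r.
Qed.

(** A discriminant argument with [b] in both coefficients: t = 1/d gives a - b/d >= 0, and for d = 0
    a large t forces b = 0. *)
Lemma le_mul_of_quadratic (a b d : R) : 0 <= a -> 0 <= b -> 0 <= d ->
  (forall t, 0 <= a - 2 * t * b + t ^+ 2 * b * d) -> b <= a * d.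
Proof.
move=> a0 b0 d0 H; have [dz|dn] := eqVneq d 0.
  subst d; rewrite mulr0; have [//|bp] := leP b 0.
  have := H ((a + 1) / (2 * b)); rewrite mulr0 addr0.
  suff -> : 2 * ((a + 1) / (2 * b)) * b = a + 1 by lra.
  by field; rewrite gt_eqF.
have dp : 0 < d by rewrite lt_neqAle eq_sym dn.
have := H d^-1; have -> : a - 2 * d^-1 * b + d^-1 ^+ 2 * b * d = a - b / d by field.
by rewrite subr_ge0 ler_pdivrMr.
Qed.

Lemma normc_sqr z : (normc z ^+ 2)%:C = z * conjc z.
Proof. by rewrite -sqr_normc rmorphXn. Qed.

Lemma pick_cauchy_schwarz f z w : pick_function f -> 0 < complex.Im z -> 0 < complex.Im w ->
  normc (nkernel f z w) ^+ 2 <=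
  complex.Im (f z) / complex.Im z * (complex.Im (f w) / complex.Im w).
Proof.
move=> pf z0 w0; have [_ _ H] := pf.
apply: le_mul_of_quadratic; rewrite ?divr_ge0 ?sqr_ge0 ?pick_Im_ge0 ?ltW // => t.
(* With coefficients 1 and -t k, where k is the kernel at z and w, all cross terms become real: the
   form is a - 2 t |k|^2 + t^2 |k|^2 d with the diagonal values a and d. *)
have := H [:: (1, z); (- (t%:C * nkernel f z w), w)].
rewrite /upper /= z0 w0 => /(_ isT).
rewrite /nform !big_cons !big_nil /= !nkernel_diag // -(nkernel_conj f z w).
move: (nkernel f z w) (_ / _) (_ / _) => k d a.
have -> : conjc (- (t%:C * k)) = - (t%:C * conjc k) by rewrite -mulrN -[in RHS]mulrN -conjN -[t%:C in RHS]conjc_real -conjM.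
rewrite -ler0c rmorph1 => /le_trans; apply.
rewrite le_eqVlt; apply/orP; left; apply/eqP.
have E : (a - 2 * t * normc k ^+ 2 + t ^+ 2 * normc k ^+ 2 * d)%:C =
   a%:C - 2 * t%:C * (normc k ^+ 2)%:C + t%:C ^+ 2 * (normc k ^+ 2)%:C * d%:C.
  by rewrite !(rmorphD, rmorphN, rmorphM, rmorph1) /=; ring.
by rewrite E normc_sqr; ring.
Qed.

Lemma near_pinfty_le (a b D : R) : (\forall y \near +oo, a <= b + D / y) -> a <= b.
Proof.
move=> H; rewrite leNgt; apply/negP => ba.
near (+oo : set_system R) => y.
have : a <= b + D / y by near: y.
apply/negP; rewrite -ltNge -ltrBrDl.
have y0 : 0 < y by apply: (@lt_le_trans _ _ 1) => //; near: y; exact: near_ge1.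
rewrite ltr_pdivrMr // -ltr_pdivrMl ?subr_gt0 //.
by near: y; apply: nbhs_pinfty_gt; exact: num_real.
Unshelve. all: by end_near. Qed.

Lemma conjc_iy y : conjc (iy y) = - iy y :> R[i].
Proof. by rewrite /iy /conjc; simpc. Qed.

Lemma normc_conj z : normc (conjc z) = normc z.
Proof. by case: z => a b; rewrite /conjc /= sqrrN. Qed.

(* Schwarz-Pick between z and iy, as y tends to infinity. *)
Lemma pick_decay_bound f z (C : R) : pick_function f -> 0 < complex.Im z ->
  (\forall y \near +oo, normc (f (iy y)) <= C / y) ->
  complex.Im z * normc (f z) ^+ 2 <= C * complex.Im (f z).
Proof.
move=> pf z0 H.
have [a0 n0] : 0 <= complex.Im (f z) / complex.Im z /\ 0 <= normc z.
  by split; [rewrite divr_ge0 ?pick_Im_ge0 // ltW|exact: normc_ge0].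
have C0 : 0 <= C.
  near (+oo : set_system R) => y.
  have y0 : 0 < y by apply: (@lt_le_trans _ _ 1) => //; near: y; exact: near_ge1.
  have : normc (f (iy y)) <= C / y by near: y.
  by move=> /(le_trans (normc_ge0 _)); rewrite ler_pdivlMr ?mul0r.
suff : normc (f z) ^+ 2 <= complex.Im (f z) / complex.Im z * C.
  by rewrite mulrAC ler_pdivlMr // mulrC [X in _ <= X]mulrC.
set a := _ / _ in a0 *; set N := normc (f z); set Z := normc z in n0.
(* Cauchy-Schwarz between z and iy bounds |f(z) - conj f(iy)|^2 by a (C/y^2) |z + iy|^2. For y >= 1
   the errors are a C (2Z + Z^2)/y, from |z + iy| <= Z + y, and 2NC/y, from f(iy). *)
apply: (@near_pinfty_le _ _ (a * C * (2 * Z + Z ^+ 2) + 2 * N * C)); near=> y.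
have y1 : 1 <= y by near: y; exact: near_ge1.
have y0 : 0 < y by exact: lt_le_trans y1.
have fy : normc (f (iy y)) <= C / y by near: y.
have iy0 : 0 < complex.Im (iy y) by [].
have := pick_cauchy_schwarz pf z0 iy0.
rewrite -/a /nkernel normcM normcV conjc_iy opprK /= => CS.
have fNy : complex.Im (f (iy y)) <= C / y by exact: le_trans (Im_le_normc _) fy.
have zy : 0 < normc (z + iy y).
  have := sub_conj_neq0 z0 iy0; rewrite conjc_iy opprK => h.
  by rewrite lt0r normc_ge0 andbT; apply: contraNneq h => /eq0_normc ->.
have zyle : normc (z + iy y) <= Z + y.
  by apply: le_trans (le_normcD _ _) _; rewrite normc_iy.
have Nle : N <= normc (f z - conjc (f (iy y))) + C / y.
  rewrite /N -[f z in leLHS](subrK (conjc (f (iy y)))).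
  by apply: le_trans (le_normcD _ _) _; rewrite normc_conj lerD2l.
move: CS Nle; set u := normc (f z - _); set v := normc (z + _) in zy zyle *.
have u0 : 0 <= u by exact: normc_ge0.
have N0 : 0 <= N by exact: normc_ge0.
rewrite expr_div_n ler_pdivrMr ?exprn_gt0 // => CS Nle.
have : u ^+ 2 <= a * (C / y / y) * (Z + y) ^+ 2.
  have P1 : complex.Im (f (iy y)) / y <= C / y / y by rewrite ler_pM2r ?invr_gt0.
  have P2 : 0 <= complex.Im (f (iy y)) / y.
    by rewrite divr_ge0 ?(ltW y0) //; exact: pick_Im_ge0.
  have P3 : v ^+ 2 <= (Z + y) ^+ 2.
    by rewrite ler_pXn2r // ?nnegrE ?(ltW zy) // addr_ge0 // ltW.
  apply: (le_trans CS); apply: ler_pM => //.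
  - exact: mulr_ge0 a0 P2.
  - exact: sqr_ge0.
  - exact: ler_wpM2l P1.
have -> : a * (C / y / y) * (Z + y) ^+ 2 = a * C * (1 + 2 * Z / y + Z ^+ 2 / y / y).
  by field; rewrite gt_eqF.
set t := y^-1.
have t0 : 0 <= t by rewrite invr_ge0 ltW.
have t1 : t <= 1 by rewrite invf_le1.
move=> ule.
(* N^2 - u^2 <= 2N(N - u) always holds, and N - u <= C t; this keeps the error linear in t. *)
have N2 : N ^+ 2 <= u ^+ 2 + 2 * N * (C * t).
  have P1 : 0 <= N * (u + C * t - N) by rewrite mulr_ge0 // subr_ge0.
  have P2 : 0 <= (N - u) ^+ 2 by exact: sqr_ge0.
  have -> : u ^+ 2 + 2 * N * (C * t) = N ^+ 2 + (2 * (N * (u + C * t - N)) + (N - u) ^+ 2) by ring.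
  by rewrite lerDl addr_ge0 // mulr_ge0.
have acZ : a * C * (Z ^+ 2 * t * t) <= a * C * (Z ^+ 2 * t).
  by apply: ler_wpM2l; [exact: mulr_ge0|apply: ler_piMr => //; rewrite mulr_ge0 ?sqr_ge0].
rewrite -/t in ule *.
have -> : (a * C * (2 * Z + Z ^+ 2) + 2 * N * C) * t =
  a * C * (2 * Z * t) + a * C * (Z ^+ 2 * t) + 2 * N * (C * t) by ring.
lra.
Unshelve. all: by end_near. Qed.

End Pick.

(** * Stability of Pick functions under -1/f and under removal of linear terms *)

Section PickClosure.
Variable R : realType.
Implicit Types (f F g h : R[i] -> R[i]) (z w : R[i]) (s : seq (R[i] * R[i])).

Lemma nonreal_conj z : nonreal z -> nonreal (conjc z).
Proof. by case: z => a b; rewrite /nonreal /conjc /= oppr_eq0. Qed.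

Lemma nonreal_upper z : 0 < complex.Im z -> nonreal z.
Proof. by rewrite /nonreal => /lt0r_neq0. Qed.

Lemma nonrealP z : nonreal z -> 0 < complex.Im z \/ 0 < complex.Im (conjc z).
Proof.
case: z => a b; rewrite /nonreal /conjc /= oppr_gt0.
by rewrite neq_lt => /orP[]; [right|left].
Qed.

Lemma conj_realM (c : R) z : conjc (c%:C * z) = c%:C * conjc z.
Proof. by rewrite conjM conjc_real. Qed.

(** A zero u makes the right-hand side of Cauchy-Schwarz vanish, so the kernel at w and u is 0,
    which means f(w) = conj f(u) = 0; reflection carries this across the real line. *)
Lemma pick_eq0 f z : pick_function f -> nonreal z -> f z = 0 ->
  forall w, nonreal w -> f w = 0.
Proof.
move=> pf; have [_ fJ _] := pf.
have up u : 0 < complex.Im u -> f u = 0 -> forall w, 0 < complex.Im w -> f w = 0.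
  move=> u0 fu w w0; have := pick_cauchy_schwarz pf w0 u0.
  rewrite fu [complex.Im 0]/= mul0r mulr0 => K0.
  have /eqP : normc (nkernel f w u) ^+ 2 = 0.
    by apply/eqP; rewrite eq_le K0 sqr_ge0.
  rewrite expf_eq0 /= => /eqP/eq0_normc/eqP.
  rewrite /nkernel mulf_eq0 invr_eq0 (negbTE (sub_conj_neq0 w0 u0)) orbF fu.
  by rewrite rmorph0 subr0 => /eqP.
have J u : nonreal u -> f u = 0 -> f (conjc u) = 0 by move=> nu fu; rewrite -fJ // fu rmorph0.
move=> nz fz w nw.
have {up}up : forall u, 0 < complex.Im u -> f u = 0.
  have [z0|z0] := nonrealP nz; first exact: up z0 fz.
  exact: up z0 (J _ nz fz).
have [w0|w0] := nonrealP nw; first exact: up.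
by rewrite -(conjcK w); apply: J; [exact: nonreal_conj|exact: up].
Qed.

Lemma pick_neq0 f z : pick_function f -> ~ rational_off_real f -> nonreal z -> f z != 0.
Proof.
move=> pf nr nz; apply/negP => /eqP fz; apply: nr; exists 0, 1 => w nw.
by rewrite hornerC oner_eq0 horner0 mul0r (pick_eq0 pf nz fz nw).
Qed.

(** The kernel of -1/f at z, w is that of f divided by f(z) conj f(w), so the form of -1/f is the
    form of f with each coefficient divided by the value of f at its point. *)
Lemma pick_opp_inv f : pick_function f -> (forall z, nonreal z -> f z != 0) ->
  pick_function (fun z => - (f z)^-1).
Proof.
move=> [df fJ fP] f0; split => [z nz|z nz|s us].
- apply: derivableN; apply: derivableV; [exact: f0|exact: df].
- by rewrite conjN conjc_inv fJ.
have := fP [seq (a.1 / f a.2, a.2) | a <- s].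
have -> : upper [seq (a.1 / f a.2, a.2) | a <- s] by rewrite /upper all_map.
move=> /(_ isT); congr (0 <= _).
rewrite /nform big_map; apply: eq_big_seq => a sa.
rewrite big_map; apply: eq_big_seq => b sb /=.
have a0 : f a.2 != 0 by apply: f0; apply: nonreal_upper; exact: (allP us).
have b0 : conjc (f b.2) != 0.
  by rewrite conjc_eq0; apply: f0; apply: nonreal_upper; exact: (allP us).
rewrite /nkernel conjM conjc_inv conjN conjc_inv mulrA [in RHS]mulrA; congr (_ / _).
by field; rewrite a0 b0.
Qed.

Lemma nkernelB_lin F (l c : R) z w : z - conjc w != 0 ->
  nkernel F z w = nkernel (fun z => F z - l%:C * z - c%:C) z w + l%:C.
Proof.
move=> zw; rewrite /nkernel !conjB conj_realM conjc_real; field; exact: zw.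
Qed.

(** The kernel of l z + c is the constant l, so the linear part contributes l |S|^2 with S the sum
    of the coefficients; it disappears when S = 0. *)
Lemma nformB_lin F (l c : R) s : upper s ->
  nform F s = nform (fun z => F z - l%:C * z - c%:C) s +
    l%:C * (\sum_(a <- s) a.1) * conjc (\sum_(a <- s) a.1).
Proof.
move=> us; rewrite /nform rmorph_sum -mulrA big_distrlr big_distrr -big_split /=.
apply: eq_big_seq => a sa; rewrite big_distrr -big_split /=.
apply: eq_big_seq => b sb.
rewrite (@nkernelB_lin _ l c) ?sub_conj_neq0 ?(allP us) //; ring.
Qed.

Lemma derivable_sub_lin F (a b z : R[i]) :
  derivable (F : R[i]^o -> R[i]^o) z 1 ->
  derivable ((fun z => F z - a * z - b) : R[i]^o -> R[i]^o) z 1.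
Proof.
move=> dF.
have di : derivable (id : R[i]^o -> R[i]^o) z 1 by exact: derivable_id.
have da := @derivableZ _ _ _ _ a _ _ di.
have db : derivable (cst b : R[i]^o -> R[i]^o) z 1 by exact: derivable_cst.
exact: derivableB (derivableB dF da) db.
Qed.

Lemma decay_sum (s : seq (R[i] * R[i])) n (g : R[i] * R[i] -> R -> R[i]) :
  (forall a, a \in s -> decay n (g a)) -> decay n (fun y => \sum_(a <- s) g a y).
Proof.
elim: s => [|a s IH] H.
  by exists 0 => //; near=> y; rewrite big_nil normc0 mul0r.
have := decayD (H a (mem_head _ _)) (IH (fun b sb => H b (mem_behead (s := a :: s) sb))).
by apply: decay_eq => y _; rewrite big_cons.
Unshelve. all: by end_near. Qed.

Lemma decay_conj n (g : R -> R[i]) : decay n g -> decay n (fun y => conjc (g y)).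
Proof.
by move=> [C C0 Cg]; exists C => //; apply: filterS Cg => y; rewrite normc_conj.
Qed.

Lemma decay_nkernel g z : decay 0 (fun y => g (iy y)) ->
  decay 1 (fun y => nkernel g z (iy y)).
Proof.
move=> dg; have d1 : decay 1 (fun y => (z + iy y)^-1).
  exists 2 => //; near=> y.
  have y0 : 0 < y by apply: (@lt_le_trans _ _ 1) => //; near: y; exact: near_ge1.
  have zy : 2 * normc z <= y by near: y; apply: nbhs_pinfty_ge; exact: num_real.
  have : normc (iy y) <= normc (z + iy y) + normc z.
    rewrite -[iy y in leLHS](addKr z) addrC -[normc z in leRHS]normcN; exact: le_normcD.
  rewrite normc_iy // => H.
  have H2 : y / 2 <= normc (z + iy y) by lra.
  have y2 : 0 < y / 2 by rewrite divr_gt0.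
  by rewrite normcV expr1 -invf_div lef_pV2 ?posrE // (lt_le_trans y2).
have := decayM (decayD (decay_cst (g z)) (decay_conj (decayM (decay_cst (-1)) dg))) d1.
apply: decay_eq => y _.
by rewrite /nkernel conjc_iy opprK mulN1r conjN.
Unshelve. all: by end_near. Qed.

Lemma decay_nkernel_diag g : decay 0 (fun y => g (iy y)) ->
  decay 1 (fun y => nkernel g (iy y) (iy y)).
Proof.
move=> dg.
have := decayM (decayD dg (decay_conj (decayM (decay_cst (-1)) dg)))
  (decayM (decay_cst 2^-1) (@decay_iyV R)).
apply: decay_eq => y /iy_neq0 y0.
rewrite /nkernel conjc_iy opprK mulN1r conjN. rewrite -[X in _ = _ / X]mulr2n -[X in _ = _ / X]mulr_natl invfM; ring.
Qed.

Lemma decay1_ge0 (x : R[i]) (e : R -> R[i]) : decay 1 e ->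
  (\forall y \near +oo, 0 <= x + e y) -> 0 <= x.
Proof.
move=> [C C0 He] H.
rewrite lecE /= -normr_le0 -oppr_le0; apply/andP.
split; apply: (@near_pinfty_le _ _ _ C); apply: filterS2 He H => y ey;
  rewrite expr1 in ey; rewrite lecE ImD ReD [complex.Im 0]/= [complex.Re 0]/= add0r => /andP[/eqP xI xR].
  apply: (le_trans _ ey); have -> : complex.Im x = - complex.Im (e y);
    rewrite ?normrN ?normIm_le_normc //; lra.
apply: (le_trans _ (le_trans (le_trans (ler_norm _) (normRe_le_normc (e y))) ey)); lra.
Qed.

(* The quadratic form of F at s extended by the point iy with coefficient
   - (sum of the coefficients) loses its l-part and tends to the quadratic
   form of F - l z at s. *)
Lemma pick_sub_lin F (l c : R) : pick_function F ->
  decay 0 (fun y => F (iy y) - l%:C * iy y - c%:C) ->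
  pick_function (fun z => F z - l%:C * z - c%:C).
Proof.
move=> [dF FJ FP] dg; split => [z nz|z nz|s us].
- by apply: derivable_sub_lin; exact: dF.
- by rewrite !conjB conj_realM conjc_real FJ.
set H := fun z => _; set S := \sum_(a <- s) a.1.
(* All terms of the extended form of [H] in which the point iy occurs; each is O(1/y) because H(iy)
   stays bounded for large y. *)
pose e y := \sum_(b <- s) - S * conjc b.1 * conjc (nkernel H b.2 (iy y)) +
   \sum_(a <- s) a.1 * - conjc S * nkernel H a.2 (iy y) +
   S * conjc S * nkernel H (iy y) (iy y).
apply: (@decay1_ge0 _ e).
  apply: decayD; [apply: decayD|].
  - apply: decay_sum => b _; rewrite -[1%N]add0n.
    by apply: decayM; [exact: decay_cst|apply: decay_conj; exact: decay_nkernel].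
  - apply: decay_sum => b _; rewrite -[1%N]add0n.
    by apply: decayM; [exact: decay_cst|exact: decay_nkernel].
  - by rewrite -[1%N]add0n; apply: decayM; [exact: decay_cst|exact: decay_nkernel_diag].
apply: filterS (@near_ge1 R) => y /(lt_le_trans ltr01) y0.
have us' : upper ((- S, iy y) :: s) by rewrite /upper /= y0.
have := FP _ us'; rewrite (@nformB_lin _ l c) // -/H big_cons /= addNr mulr0 mul0r addr0.
rewrite /nform !big_cons /=.
under [X in _ + X]eq_bigr do rewrite big_cons /=.
rewrite big_split /= conjN; congr (0 <= _).
rewrite /e; set A := \sum_(a <- s) \sum_(b <- s) _.
have -> : \sum_(b <- s) - S * conjc b.1 * nkernel H (iy y) b.2 =
    \sum_(b <- s) - S * conjc b.1 * conjc (nkernel H b.2 (iy y)).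
  by apply: eq_bigr => b _; rewrite nkernel_conj.
ring.
Qed.

End PickClosure.

(** * From asymptotic expansions to continued fractions *)

Section Expansion.
Variable R : realType.
Implicit Types (f g : R[i] -> R[i]) (z w : R[i]).

(** Serves contrapositively: if f is not rational, neither is the remainder left after inverting f
    and removing a linear term. *)
Lemma rational_inv_lin f g (l c : R) : rational_off_real g ->
  (forall z, nonreal z -> f z != 0 /\ - (f z)^-1 = l%:C * z + c%:C + g z) ->
  rational_off_real f.
Proof.
move=> [p [q pq]] H.
exists (- q), ((l%:C *: 'X + c%:C%:P) * q + p) => z nz.
have [q0 gz] := pq z nz; have [f0 fz] := H z nz.
rewrite hornerN hornerD hornerM hornerD hornerZ hornerX hornerC.
have fE : f z = - (l%:C * z + c%:C + g z)^-1 by rewrite -fz invrN invrK opprK.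
have e : (l%:C * z + c%:C) * q.[z] + p.[z] = (l%:C * z + c%:C + g z) * q.[z].
  by rewrite gz [in RHS]mulrDl divfK.
have n0 : l%:C * z + c%:C + g z != 0 by rewrite -fz oppr_eq0 invr_eq0.
split; first by rewrite e mulf_neq0.
by rewrite e fE invfM mulNr mulrCA divff // mulr1.
Qed.

Lemma Im_opp_inv w : w != 0 -> complex.Im (- w^-1) = complex.Im w / normc w ^+ 2.
Proof.
by case: w => a b _ /=; rewrite opprK sqr_sqrtr // addr_ge0 ?sqr_ge0.
Qed.

(* The constant obtained here is not the sharp one (which would need a limit of
   y |f(iy)|); this is harmless, as it only enters the last level of the
   continued fraction. *)
Lemma pick_opp_inv_lower f : pick_function f -> (forall z, nonreal z -> f z != 0) ->
  decay 1 (fun y => f (iy y)) ->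
  exists2 C : R, 0 < C &
    forall z, 0 < complex.Im z -> C * complex.Im z <= complex.Im (- (f z)^-1).
Proof.
move=> pf f0 [C C0 HC]; exists (C + 1)^-1; first by rewrite invr_gt0 ltr_wpDl.
move=> z z0; have fz : f z != 0 by apply: f0; exact: nonreal_upper.
have n0 : 0 < normc (f z).
  by rewrite lt0r normc_ge0 andbT; apply: contraNneq fz => /eq0_normc ->.
rewrite Im_opp_inv // ler_pdivlMr ?exprn_gt0 // mulrAC -mulrA ler_pdivrMl ?ltr_wpDl //.
rewrite mulrC; apply: pick_decay_bound => //.
apply: filterS2 HC (@near_ge1 R) => y fy y1.
apply: (le_trans fy); rewrite expr1 ler_pM2r ?lerDl //.
by rewrite invr_gt0 (lt_le_trans ltr01).
Qed.

(** For y >= x one has C / y^2 <= (C/x) / y, so [pick_decay_bound] applies with a constant as small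
    as desired. *)
Lemma decay2_pick_eq0 f z : pick_function f -> decay 2 (fun y => f (iy y)) ->
  0 < complex.Im z -> f z = 0.
Proof.
move=> pf [C C0 HC] z0.
suff H : complex.Im z * normc (f z) ^+ 2 <= 0.
  have : normc (f z) ^+ 2 == 0 by rewrite eq_le sqr_ge0 andbT -(pmulr_rle0 _ z0).
  by rewrite expf_eq0 /= => /eqP/eq0_normc.
apply: (@near_pinfty_le _ _ _ (C * complex.Im (f z))); near=> x.
have x0 : 0 < x by apply: (@lt_le_trans _ _ 1) => //; near: x; exact: near_ge1.
rewrite add0r mulrAC; apply: pick_decay_bound => //.
apply: filterS2 HC (nbhs_pinfty_ge (num_real x)) => y fy xy.
apply: (le_trans fy); rewrite expr2 invfM mulrA ler_pM2r ?invr_gt0 ?(lt_le_trans x0) //.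
by rewrite ler_wpM2l // lef_pV2 ?posrE // (lt_le_trans x0).
Unshelve. all: by end_near. Qed.

(** One Euclidean step -1/f = l z + c + g. If s is the constant term of f(iy) iy, then l = -1/s, and
    c is the next coefficient of -1/f; the two multiplications by iy lower the order by two. *)
Lemma pick_step f k : pick_function f -> ~ rational_off_real f ->
  asym (2 * k).+3 0 (fun y => f (iy y)) ->
  exists (l c : R), [/\ 0 < l,
    pick_function (fun z => - (f z)^-1 - l%:C * z - c%:C),
    ~ rational_off_real (fun z => - (f z)^-1 - l%:C * z - c%:C) &
    asym (2 * k).+1 0 (fun y => - (f (iy y))^-1 - l%:C * iy y - c%:C)].
Proof.
move=> pf nr af.
have f0 z : nonreal z -> f z != 0 by exact: pick_neq0.
have [s as_] := asym_mulz af.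
(* Otherwise f(iy) = O(y^-2), which forces f to vanish. *)
have s0 : s != 0.
  apply/eqP => s0; rewrite s0 in as_.
  have i0 : 0 < complex.Im (iy 1 : R[i]) by rewrite /= ltr01.
  have := f0 (iy 1) (nonreal_upper i0); rewrite (@decay2_pick_eq0 f) ?eqxx //.
  apply: decay_eq (decayM (asym_decay1 as_) (@decay_iyV R)) => y /iy_neq0 y0.
  by rewrite mulfK.
have pF := pick_opp_inv pf f0.
have [l lE] : exists l, l = - s^-1 by exists (- s^-1).
have aF : asym (2 * k).+2 0 (fun y => - (f (iy y) * iy y)^-1 - l%:C).
  have := asymD (asymN (asymV s0 as_)) (asym_cst (2 * k).+2 (- l)).
  rewrite -lE subrr.
  by apply: asym_eq => y _; rewrite [in LHS]rmorphN.
have [c ac] := asym_mulz aF.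
have ag : asym (2 * k).+1 0 (fun y => - (f (iy y))^-1 - l%:C * iy y - c%:C).
  have := asymD ac (asym_cst (2 * k).+1 (- c)); rewrite subrr.
  apply: asym_eq => y /iy_neq0 y0; rewrite [in LHS]rmorphN; congr (_ - _).
  by rewrite mulrBl invfM mulNr divfK.
have pg : pick_function (fun z => - (f z)^-1 - l%:C * z - c%:C).
  apply: (pick_sub_lin pF); exact: asym_decay0 ag.
exists l, c; split => //.
(* Positivity of l: the imaginary part of -1/f at iy is at least C y, and it is l y + O(1/y) by the
   expansion; divide by y and let y tend to infinity. *)
- have d1 : decay 1 (fun y => f (iy y)) by exact: asym_decay1 af.
  have [C C0 HC] := pick_opp_inv_lower pf f0 d1.
  have [D D0 HD] := asym_decay1 ag.
  apply: (lt_le_trans C0); apply: (@near_pinfty_le _ _ _ D).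
  apply: filterS2 HD (@near_ge1 R) => y Hy y1.
  have y0 : 0 < y by exact: lt_le_trans y1.
  have := HC (iy y) y0; rewrite [complex.Im (iy y)]/= => H1.
  have := le_trans (Im_le_normc _) Hy.
  rewrite !ImD (ImN (_ * _)) Im_realM [complex.Im (iy y)]/= expr1.
  rewrite [complex.Im (- c%:C)]/= oppr0 addr0 => H2.
  have Dy : 0 <= D / y by rewrite divr_ge0 // ltW.
  have H3 : C * y <= l * y + D / y by lra.
  rewrite -(ler_pM2r y0) mulrDl (le_trans H3) // lerD2l.
  by rewrite ler_peMr.
- move=> rg; apply: nr; apply: (rational_inv_lin (l := l) (c := c) rg) => z nz.
  by split; [exact: f0|ring].
Qed.

(** Removes only part of the linear growth of -1/f, for which [decay 1] suffices. Both g and -1/g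
    are returned as possible tails: g next to a positive upsilon, -1/g next to upsilon = 0. *)
Lemma pick_terminal f : pick_function f -> ~ rational_off_real f ->
  decay 1 (fun y => f (iy y)) ->
  exists (l : R) (g : R[i] -> R[i]), [/\ 0 < l, herglotz_nevanlinna g,
    herglotz_nevanlinna (fun z => - (g z)^-1) &
    forall z, nonreal z -> f z = - (l%:C * z + g z)^-1].
Proof.
move=> pf nr df.
have f0 z : nonreal z -> f z != 0 by exact: pick_neq0.
have [C C0 HC] := pick_opp_inv_lower pf f0 df.
have [dF FJ _] := pick_opp_inv pf f0.
(* Half of C, so that g below has positive imaginary part and cannot vanish. *)
pose l := C / 2; have l0 : 0 < l by rewrite divr_gt0.
pose g z := - (f z)^-1 - l%:C * z.
have gJ z : nonreal z -> conjc (g z) = g (conjc z).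
  by move=> nz; rewrite /g conjB FJ // conj_realM.
have g_gt0 z : 0 < complex.Im z -> 0 < complex.Im (g z).
  move=> z0; have := HC z z0; rewrite /g ImD (ImN (_ * _)) Im_realM => H.
  rewrite subr_gt0; apply: lt_le_trans H.
  by rewrite ltr_pM2r // /l gtr_pMr // invf_lt1 ?ltr1n.
have g0 z : nonreal z -> g z != 0.
  have P u : 0 < complex.Im u -> g u != 0.
    by move=> u0; apply: contraTneq (g_gt0 _ u0) => ->; rewrite ltxx.
  move=> nz; have [z0|z0] := nonrealP nz; first exact: P.
  by rewrite -conjc_eq0 gJ // P.
have gD z : nonreal z -> derivable (g : R[i]^o -> R[i]^o) z 1.
  move=> nz; have D := @derivable_sub_lin R (fun z => - (f z)^-1) l%:C 0 z (dF z nz).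
  have -> : g = (fun z => - (f z)^-1 - l%:C * z - 0) by apply/funext => u; rewrite subr0.
  exact: D.
exists l, g; split; [exact: l0| | |].
- by split; [exact: gD|move=> z /g_gt0/ltW|exact: gJ].
- split => z nz.
  + by apply: derivableN; apply: derivableV; [exact: g0|exact: gD].
  + by rewrite ImN oppr_ge0 Im_inv_le0 // ltW // g_gt0.
  + by rewrite conjN conjc_inv gJ.
- by move=> z nz; rewrite /g addrC subrK invrN invrK opprK.
Qed.

Lemma pick_tail_expansion f k : pick_function f -> ~ rational_off_real f ->
  asym (2 * k).+1 0 (fun y => f (iy y)) -> tail_expansion k f.
Proof.
elim/ltn_ind: k f => -[|k] IH f pf nr af.
  (* For k = 0 the fraction closes at once with upsilon = 0 and the tail -1/g, whose inverse is
     -g. *)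
  have [l [g [l0 _ hmt fE]]] := pick_terminal pf nr (asym_decay1 af).
  exists (fun z => - (g z)^-1), 0%N, (fun=> 0), (fun=> 0), (fun=> l).
  split; [exact: hmt|by []|by move=> n _; exact: l0|by []|split; first by []].
  move=> z nz; rewrite fE //= mul0r add0r invrN invrK mulNr -opprD invrN //.
rewrite mulnS in af.
have [l [c [l0 pg nrg ag]]] := pick_step pf nr af.
set g := fun z => _ in pg nrg.
have gE y : - (f (iy y))^-1 - l%:C * iy y - c%:C = g (iy y) by [].
have {gE}ag : asym (2 * k).+1 0 (fun y => g (iy y)) by [].
have f0 z : nonreal z -> f z != 0 by exact: pick_neq0.
have fE z : nonreal z -> f z = (- l%:C * z - (g z + c%:C))^-1.
  by move=> nz; rewrite /g subrK mulNr -opprD addrC subrK opprK invrK.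
(* If c is nonzero, then the next upsilon is 0 and omega = -1/c, at the cost of
   one unit of k; if c = 0, then the next upsilon is positive and two units are
   used, or the expansion ends when k = 1. *)
have [c0|c0] := eqVneq c 0.
  have {}fE z : nonreal z -> f z = (- l%:C * z - g z)^-1.
    by move=> nz; rewrite fE // c0 addr0.
  case: k IH {af} ag => [|k] IH ag.
    have [u [h [u0 hmt _ hE]]] := pick_terminal pg nrg (asym_decay1 ag).
    exists h, 0%N, (fun=> u), (fun=> 0), (fun=> l).
    split; [exact: hmt|by move=> n _; exact: ltW|by move=> n _; exact: l0|by []|split].
      by rewrite /= (gt_eqF u0).
    by move=> z nz; rewrite fE // hE // opprK.
  rewrite mulnS in ag.
  have [u [w [u0 ph nrh ah]]] := pick_step pg nrg ag.
  set h := fun z => _ in ph nrh.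
  have th : tail_expansion k h by apply: IH => //; rewrite ltnS leqnSn.
  have := @tail_expansion_cons _ k f h u w l th l0 (ltW u0).
  rewrite (gt_eqF u0) addn1; apply; first by rewrite ltr_pwDl.
  move=> z nz; rewrite fE //.
  have -> : u%:C * z + w%:C + h z = - (g z)^-1 by rewrite /h; ring.
  by rewrite invrN invrK.
pose G z := g z + c%:C.
have aG : asym (2 * k).+1 c (fun y => G (iy y)).
  by have := asymD ag (asym_cst (2 * k).+1 c); rewrite add0r.
have pick_shift h (d : R) : pick_function h -> decay 0 (fun y => h (iy y)) ->
    pick_function (fun z => h z - d%:C).
  move=> ph dh; have : pick_function (fun z => h z - 0%:C * z - d%:C).
    apply: pick_sub_lin => //.
    apply: decay_eq (decayD dh (decay_cst (- d%:C))) => y _.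
    by rewrite mul0r subr0.
  by under eq_fun do rewrite mul0r subr0.
have pG : pick_function G.
  have := pick_shift g (- c) pg (asym_decay0 ag).
  by under eq_fun do rewrite rmorphN opprK.
have nrG : ~ rational_off_real G.
  move=> rG; apply: nr; apply: (rational_inv_lin (l := l) (c := 0) rG) => z nz.
  by split; [exact: f0|rewrite /G /g; ring].
have G0 z : nonreal z -> G z != 0 by exact: pick_neq0.
pose h z := - (G z)^-1 + (c^-1)%:C.
have ah : asym (2 * k).+1 0 (fun y => h (iy y)).
  have := asymD (asymN (asymV c0 aG)) (asym_cst (2 * k).+1 c^-1).
  by rewrite addNr.
have ph : pick_function h.
  have := pick_shift _ (- c^-1) (pick_opp_inv pG G0) (asym_decay0 (asymN (asymV c0 aG))).
  by under eq_fun do rewrite rmorphN opprK.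
have nrh : ~ rational_off_real h.
  move=> rh; apply: nrG; apply: (rational_inv_lin (l := 0) (c := - c^-1) rh) => z nz.
  by split; [exact: G0|rewrite /h rmorphN; ring].
have th : tail_expansion k h by apply: IH.
have := @tail_expansion_cons _ k f h 0 (- c^-1) l th l0 (lexx 0).
rewrite eqxx addn0; apply; first by rewrite add0r normr_gt0 oppr_eq0 invr_eq0.
move=> z nz; rewrite fE // -/(G z) /h rmorphN mul0r add0r addrCA addNr addr0.
by rewrite invrN invrK.
Qed.

End Expansion.

(** * Herglotz measures *)

Section ComplexIntegral.
Variables (R : realType) (rho : {measure set (measurableTypeR R) -> \bar R}).
Implicit Types (f g : R -> R[i]) (z w : R[i]).

Definition ccont f := continuous (fun t => complex.Re (f t)) /\
  continuous (fun t => complex.Im (f t)).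

Lemma ccont_cst (a : R[i]) : ccont (fun=> a).
Proof. by split => t; exact: cvg_cst. Qed.

Lemma ccont_id : ccont (fun t : R => t%:C).
Proof. by split => t; [exact: cvg_id|exact: cvg_cst]. Qed.

Lemma ReM z w : complex.Re (z * w) =
  complex.Re z * complex.Re w - complex.Im z * complex.Im w.
Proof. by case: z w => ? ? []. Qed.

Lemma ImM z w : complex.Im (z * w) =
  complex.Re z * complex.Im w + complex.Im z * complex.Re w.
Proof. by case: z w => ? ? []. Qed.

Lemma ccontD f g : ccont f -> ccont g -> ccont (fun t => f t + g t).
Proof.
move=> [f1 f2] [g1 g2]; split => t.
  by under eq_fun do rewrite ReD; apply: cvgD; [exact: f1|exact: g1].
by under eq_fun do rewrite ImD; apply: cvgD; [exact: f2|exact: g2].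
Qed.

Lemma ccontM f g : ccont f -> ccont g -> ccont (fun t => f t * g t).
Proof.
move=> [f1 f2] [g1 g2]; split => t.
  under eq_fun do rewrite ReM.
  by apply: cvgB; apply: cvgM; [exact: f1|exact: g1|exact: f2|exact: g2].
under eq_fun do rewrite ImM.
by apply: cvgD; apply: cvgM; [exact: f1|exact: g2|exact: f2|exact: g1].
Qed.

Lemma ccontX f n : ccont f -> ccont (fun t => f t ^+ n).
Proof.
move=> cf; elim: n => [|n IH]; first exact: (ccont_cst 1).
by under eq_fun do rewrite exprS; exact: ccontM.
Qed.

Lemma ccontB f g : ccont f -> ccont g -> ccont (fun t => f t - g t).
Proof.
move=> cf cg; apply: ccontD => //.
by under eq_fun do rewrite -mulN1r; apply: ccontM => //; exact: ccont_cst.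
Qed.

Lemma ccontV f : (forall t, f t != 0) -> ccont f -> ccont (fun t => (f t)^-1).
Proof.
move=> f0 [f1 f2].
have n0 t : complex.Re (f t) ^+ 2 + complex.Im (f t) ^+ 2 != 0.
  move: (f0 t); case: (f t) => a b; apply: contraNneq => /eqP.
  rewrite paddr_eq0 ?sqr_ge0 // !expf_eq0 /= => /andP[/eqP -> /eqP ->].
  by rewrite eqxx.
have cn t : (fun t => complex.Re (f t) ^+ 2 + complex.Im (f t) ^+ 2) @ t -->
    complex.Re (f t) ^+ 2 + complex.Im (f t) ^+ 2.
  exact: cvgD (cvgM (f1 t) (f1 t)) (cvgM (f2 t) (f2 t)).
split => t.
  have -> : (fun t => complex.Re (f t)^-1) =
     (fun t => complex.Re (f t) * (complex.Re (f t) ^+ 2 + complex.Im (f t) ^+ 2)^-1).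
    by apply/funext => x; case: (f x).
  by apply: cvgM; [exact: f1|apply: cvgV; [exact: n0|exact: cn]].
have -> : (fun t => complex.Im (f t)^-1) =
   (fun t => - (complex.Im (f t) * (complex.Re (f t) ^+ 2 + complex.Im (f t) ^+ 2)^-1)).
  by apply/funext => x; case: (f x).
by apply: cvgN; apply: cvgM; [exact: f2|apply: cvgV; [exact: n0|exact: cn]].
Qed.

Definition cintegrable f :=
  rho.-integrable setT (EFin \o (fun t => complex.Re (f t))) /\
  rho.-integrable setT (EFin \o (fun t => complex.Im (f t))).

Local Notation CI := (complex_integral rho).

Lemma continuous_measurable (h : R -> R) : continuous h ->
  measurable_fun setT (h : measurableTypeR R -> measurableTypeR R).
Proof. exact: continuous_measurable_fun. Qed.

Lemma ge0_integrable (h : R -> R) : continuous h -> (forall t, 0 <= h t) ->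
  (\int[rho]_(t in setT) (h t)%:E < +oo)%E ->
  rho.-integrable setT (EFin \o h).
Proof.
move=> ch h0 hi; apply/integrableP; split.
  by apply/measurable_EFinP; exact: continuous_measurable.
by under eq_integral do rewrite /= ger0_norm //.
Qed.

Lemma continuous_le_integrable (h k : R -> R) : continuous h ->
  (forall t, `|h t| <= k t) -> rho.-integrable setT (EFin \o k) ->
  rho.-integrable setT (EFin \o h).
Proof.
move=> ch hk; apply: le_integrable => //.
  by apply/measurable_EFinP; exact: continuous_measurable.
by move=> t _; rewrite lee_fin (le_trans (hk t)) // ler_norm.
Qed.

Lemma cintegrable_le f (k : R -> R) : ccont f -> (forall t, normc (f t) <= k t) ->
  rho.-integrable setT (EFin \o k) -> cintegrable f.
Proof.
move=> [f1 f2] fk ik; split; apply: continuous_le_integrable ik => // t.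
  exact: le_trans (normRe_le_normc _) (fk t).
exact: le_trans (normIm_le_normc _) (fk t).
Qed.

Lemma normc_le_ReIm z : normc z <= `|complex.Re z| + `|complex.Im z|.
Proof.
case: z => a b /=; rewrite -[leRHS]ger0_norm ?addr_ge0 // -sqrtr_sqr.
rewrite ler_wsqrtr // sqrrD !real_normK ?num_real // addrAC lerDl.
by rewrite mulrn_wge0 // mulr_ge0.
Qed.

(** Bounding the real and imaginary parts separately costs a factor 2, which is harmless in
    O-estimates. *)
Lemma complex_integral_le f (k : R -> R) : ccont f -> (forall t, normc (f t) <= k t) ->
  rho.-integrable setT (EFin \o k) ->
  normc (CI f) <= 2 * Rintegral rho setT k.
Proof.
move=> cf fk ik; have [i1 i2] := cintegrable_le cf fk ik.
apply: le_trans (normc_le_ReIm _) _; rewrite mulr2n mulrDl mul1r /=.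
have H (h : R -> R) : rho.-integrable setT (EFin \o h) -> (forall t, `|h t| <= k t) ->
    `|Rintegral rho setT h| <= Rintegral rho setT k.
  move=> ih hk; apply: le_trans (le_normr_Rintegral measurableT ih) _.
  by apply: le_Rintegral => //; exact: integrable_norm.
by apply: lerD; apply: H => // t; apply: le_trans (fk t);
  [exact: normRe_le_normc|exact: normIm_le_normc].
Qed.

Lemma cintegrableD f g : cintegrable f -> cintegrable g -> cintegrable (fun t => f t + g t).
Proof.
move=> [f1 f2] [g1 g2]; split.
  have := integrableD measurableT f1 g1; apply: eq_integrable => // t _.
  by rewrite /= ReD.
have := integrableD measurableT f2 g2; apply: eq_integrable => // t _.
by rewrite /= ImD.
Qed.

Lemma complex_integralD f g : cintegrable f -> cintegrable g ->
  CI (fun t => f t + g t) = CI f + CI g.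
Proof.
move=> [f1 f2] [g1 g2]; rewrite /complex_integral; congr Complex.
  by rewrite -RintegralD //; apply: eq_Rintegral => t _; rewrite ReD.
by rewrite -RintegralD //; apply: eq_Rintegral => t _; rewrite ImD.
Qed.

Lemma cintegrableZ (a : R[i]) f : cintegrable f -> cintegrable (fun t => a * f t).
Proof.
move=> [f1 f2]; split.
  have := integrableB measurableT (integrableZl measurableT (complex.Re a) f1)
    (integrableZl measurableT (complex.Im a) f2).
  by apply: eq_integrable => // t _; rewrite /= ReM.
have := integrableD measurableT (integrableZl measurableT (complex.Re a) f2)
  (integrableZl measurableT (complex.Im a) f1).
by apply: eq_integrable => // t _; rewrite /= ImM.
Qed.

Lemma complex_integralZ (a : R[i]) f : cintegrable f ->
  CI (fun t => a * f t) = a * CI f.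
Proof.
move=> [f1 f2]; have Z (c : R) (h : R -> R) : rho.-integrable setT (EFin \o h) ->
   rho.-integrable setT (EFin \o (fun t => c * h t)).
  by move=> ih; have := integrableZl measurableT c ih; apply: eq_integrable.
apply/eqP; rewrite eq_complex ReM ImM /=; apply/andP; split; apply/eqP.
  rewrite -!RintegralZl // -RintegralB //; try exact: Z.
  by apply: eq_Rintegral => t _; rewrite ReM.
rewrite -!RintegralZl // -RintegralD //; try exact: Z.
by apply: eq_Rintegral => t _; rewrite ImM.
Qed.

Lemma cintegrable0 : cintegrable (fun=> 0).
Proof. by split; exact: integrable0. Qed.

Lemma complex_integral0 : CI (fun=> 0) = 0.
Proof.
by rewrite /complex_integral /Rintegral /= !integral0.
Qed.

Lemma cintegrable_sum (I : eqType) (s : seq I) (F : I -> R -> R[i]) :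
  (forall i, i \in s -> cintegrable (F i)) -> cintegrable (fun t => \sum_(i <- s) F i t).
Proof.
elim: s => [|i s IH] H.
  by under eq_fun do rewrite big_nil; exact: cintegrable0.
under eq_fun do rewrite big_cons.
apply: cintegrableD; first by apply: H; rewrite mem_head.
by apply: IH => j js; apply: H; rewrite inE js orbT.
Qed.

Lemma complex_integral_sum (I : eqType) (s : seq I) (F : I -> R -> R[i]) :
  (forall i, i \in s -> cintegrable (F i)) ->
  CI (fun t => \sum_(i <- s) F i t) = \sum_(i <- s) CI (F i).
Proof.
elim: s => [|i s IH] H.
  by under eq_fun do rewrite big_nil; rewrite complex_integral0 big_nil.
under eq_fun do rewrite big_cons.
have H' j : j \in s -> cintegrable (F j) by move=> js; apply: H; rewrite inE js orbT.
rewrite complex_integralD ?big_cons ?IH //; first by apply: H; rewrite mem_head.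
exact: cintegrable_sum.
Qed.

Lemma complex_integral_ge0 f : (forall t, 0 <= f t) -> 0 <= CI f.
Proof.
move=> f0; have H t := f0 t; rewrite lecE /=; apply/andP; split.
  rewrite (@eq_Rintegral _ _ _ _ _ (fun=> 0)) /Rintegral ?integral0 // => t _.
  by move: (f0 t); rewrite lecE => /andP[/eqP].
by apply: Rintegral_ge0 => t _; move: (f0 t); rewrite lecE => /andP[].
Qed.

End ComplexIntegral.

(** * Pick positivity from the integral representation *)

Section HerglotzMeasure.
Variables (R : realType) (rho : {measure set (measurableTypeR R) -> \bar R}).
Implicit Types (z w : R[i]) (k n : nat).
Local Notation CI := (complex_integral rho).

Lemma sub_real_neq0 (t : R) z : nonreal z -> t%:C - z != 0.
Proof.
case: z => a b; rewrite /nonreal /= eq_complex negb_and /= => b0.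
by rewrite sub0r oppr_eq0 b0 orbT.
Qed.

Lemma ccont_subV z : nonreal z -> ccont (fun t : R => (t%:C - z)^-1).
Proof.
move=> nz; apply: ccontV => [t|]; first exact: sub_real_neq0.
by apply: ccontB; [exact: ccont_id|exact: ccont_cst].
Qed.

Lemma normc_sub_real (t : R) z :
  normc (t%:C - z) ^+ 2 = (t - complex.Re z) ^+ 2 + complex.Im z ^+ 2.
Proof.
case: z => x y; rewrite -[t%:C - _]/((t - x) +i* (0 - y)) /normc /= sub0r sqrrN.
by rewrite sqr_sqrtr // addr_ge0 ?sqr_ge0.
Qed.

Lemma normc_subV_le z : nonreal z -> exists2 C : R, 0 <= C &
  forall t : R, normc ((t%:C - z)^-1) ^+ 2 <= C / (1 + t ^+ 2).
Proof.
rewrite /nonreal; set x := complex.Re z; set y := complex.Im z => y0.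
have y2 : 0 < y ^+ 2 by rewrite lt0r sqrf_eq0 y0 sqr_ge0.
(* From t^2 <= 2 (t - x)^2 + 2 x^2, the quotient (1 + t^2) / ((t - x)^2 + y^2) is at most 2 + (2 x^2
   + 1) / y^2. *)
exists (2 + (2 * x ^+ 2 + 1) / y ^+ 2).
  have x2 := sqr_ge0 x; apply: addr_ge0 => //; apply: divr_ge0; [lra|exact: ltW].
move=> t; rewrite normcV exprVn normc_sub_real -/x -/y.
have t1 : 0 < 1 + t ^+ 2 by rewrite ltr_pwDl // sqr_ge0.
have d0 : 0 < (t - x) ^+ 2 + y ^+ 2 by rewrite ltr_wpDl // sqr_ge0.
rewrite ler_pdivlMr // mulrC ler_pdivrMr //.
set A := (t - x) ^+ 2; set Q := (_ + 1) / _.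
have Qy : Q * y ^+ 2 = 2 * x ^+ 2 + 1 by rewrite divfK // gt_eqF.
have A0 : 0 <= A by exact: sqr_ge0.
have Q0 : 0 <= Q.
  by have x2 := sqr_ge0 x; apply: divr_ge0; [lra|exact: ltW].
have QA : 0 <= Q * A by exact: mulr_ge0.
have -> : (2 + Q) * (A + y ^+ 2) = 2 * A + 2 * y ^+ 2 + Q * A + Q * y ^+ 2 by ring.
have At : t ^+ 2 <= 2 * A + 2 * x ^+ 2.
  rewrite -subr_ge0 /A; have -> : 2 * (t - x) ^+ 2 + 2 * x ^+ 2 - t ^+ 2 = (t - 2 * x) ^+ 2 by ring.
  exact: sqr_ge0.
rewrite Qy; lra.
Qed.

Definition cauchy_kernel z w (t : R) : R[i] := (t%:C - z)^-1 * (t%:C - w)^-1.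

Definition poisson_finite := (\int[rho]_(t in setT) ((1 + t ^+ 2)^-1)%:E < +oo)%E.

Lemma continuous_poisson : continuous (fun t : R => (1 + t ^+ 2)^-1).
Proof.
move=> t; apply: cvgV; first by rewrite gt_eqF // ltr_pwDl // sqr_ge0.
apply: cvgD; first exact: cvg_cst.
exact: exprn_continuous.
Qed.

Lemma poisson_integrable (C : R) : poisson_finite ->
  rho.-integrable setT (EFin \o (fun t : R => C / (1 + t ^+ 2))).
Proof.
move=> fin; have := @ge0_integrable _ rho _ continuous_poisson _ fin.
have P t : 0 <= (1 + t ^+ 2 : R)^-1 by rewrite invr_ge0 addr_ge0 // sqr_ge0.
by move=> /(_ P)/(integrableZl measurableT C); apply: eq_integrable.
Qed.

Lemma cintegrable_kernel z w : poisson_finite -> nonreal z -> nonreal w ->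
  cintegrable rho (cauchy_kernel z w).
Proof.
move=> fin nz nw; have [C C0 HC] := normc_subV_le nz; have [D D0 HD] := normc_subV_le nw.
(* u v <= u^2 + v^2 reduces the product to the two squared bounds, hence the constant C + D. *)
apply: (@cintegrable_le _ _ _ (fun t => (C + D) / (1 + t ^+ 2))).
- by apply: ccontM; exact: ccont_subV.
- move=> t; rewrite normcM mulrDl; have := HC t; have := HD t.
  set u := normc _; set v := normc _ => H1 H2.
  have u0 : 0 <= u by exact: normc_ge0.
  have v0 : 0 <= v by exact: normc_ge0.
  nra.
- exact: poisson_integrable.
Qed.

Definition nevanlinna_kernel z (t : R) : R[i] := (t%:C - z)^-1 - (t / (1 + t ^+ 2))%:C.

(* Partial fractions of t/(1 + t^2) at t = i, -i. *)
Lemma nevanlinna_kernelE z : nonreal z ->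
  nevanlinna_kernel z = (fun t => 2^-1 * (z - iy 1) * cauchy_kernel z (iy 1) t +
    2^-1 * (z + iy 1) * cauchy_kernel z (- iy 1) t).
Proof.
move=> nz; apply/funext => t; rewrite /nevanlinna_kernel /cauchy_kernel.
have ni : nonreal (iy 1 : R[i]) by rewrite /nonreal /= oner_eq0.
have ni' : nonreal (- iy 1 : R[i]) by rewrite /nonreal /= oppr_eq0 oner_eq0.
have z0 := sub_real_neq0 t nz; have i0 := sub_real_neq0 t ni.
have i0' := sub_real_neq0 t ni'.
have t0 : (1 + t ^+ 2)%:C != 0.
  by rewrite eq_complex /= eqxx andbT gt_eqF // ltr_pwDl // sqr_ge0.
have -> : (t / (1 + t ^+ 2))%:C = t%:C / ((t%:C - iy 1) * (t%:C - - iy 1)).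
  rewrite rmorphM fmorphV; congr (_ / _); rewrite /iy; simpc.
  by apply/eqP; rewrite eq_complex /=; apply/andP; split; apply/eqP; ring.
field.
by rewrite -[iy 1]opprK z0 opprK i0 i0'.
Qed.

Lemma cintegrable_nevanlinna z : poisson_finite -> nonreal z ->
  cintegrable rho (nevanlinna_kernel z).
Proof.
move=> fin nz; rewrite nevanlinna_kernelE //.
have ni : nonreal (iy 1 : R[i]) by rewrite /nonreal /= oner_eq0.
have ni' : nonreal (- iy 1 : R[i]) by rewrite /nonreal /= oppr_eq0 oner_eq0.
by apply: cintegrableD; apply: cintegrableZ; exact: cintegrable_kernel.
Qed.

(** The resolvent identity 1/(t - z) - 1/(t - w) = (z - w) / ((t - z)(t - w)) under the integral;
    the subtracted term t / (1 + t^2) cancels. *)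
Lemma nevanlinna_integralB z w : poisson_finite -> nonreal z -> nonreal w ->
  CI (nevanlinna_kernel z) - CI (nevanlinna_kernel w) = (z - w) * CI (cauchy_kernel z w).
Proof.
move=> fin nz nw.
rewrite -complex_integralZ; last exact: cintegrable_kernel.
rewrite -[- CI _]mulN1r -complex_integralZ; last exact: cintegrable_nevanlinna.
rewrite -complex_integralD; first last.
- by apply: cintegrableZ; exact: cintegrable_nevanlinna.
- exact: cintegrable_nevanlinna.
congr complex_integral; apply/funext => t.
have z0 := sub_real_neq0 t nz; have w0 := sub_real_neq0 t nw.
rewrite /nevanlinna_kernel /cauchy_kernel mulN1r opprB addrA subrK.
by field; rewrite z0 w0.
Qed.

(** By the resolvent identity the kernel of m is b plus the integral of 1/((t - z)(t - conj w)). So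
    the form is b |S|^2 plus the integral of |sum of a / (t - z_a)|^2, where S is the sum of the
    coefficients a. *)
Lemma herglotz_pick (m : R[i] -> R[i]) : herglotz_nevanlinna m ->
  herglotz_measure m rho -> pick_function m.
Proof.
move=> [dm _ mJ] [fin [a [b [b0 mE]]]]; split => // s us.
have K z w : 0 < complex.Im z -> 0 < complex.Im w ->
    nkernel m z w = b%:C + CI (cauchy_kernel z (conjc w)).
  move=> z0 w0; have nz := nonreal_upper z0; have nw := nonreal_conj (nonreal_upper w0).
  apply: (mulIf (sub_conj_neq0 z0 w0)).
  rewrite /nkernel divfK ?sub_conj_neq0 // mJ; last exact: nonreal_upper.
  rewrite (mE z nz) (mE _ nw) mulrDl.
  by rewrite [CI _ * _]mulrC -nevanlinna_integralB //; rewrite /nevanlinna_kernel; ring.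
have CK (p : (R[i] * R[i]) * (R[i] * R[i])) : p.1 \in s -> p.2 \in s ->
    cintegrable rho (cauchy_kernel p.1.2 (conjc p.2.2)).
  move=> /(allP us)/nonreal_upper n1 /(allP us)/nonreal_upper n2.
  by apply: cintegrable_kernel => //; exact: nonreal_conj.
pose S := \sum_(a <- s) a.1.
pose F t := \sum_(a <- s) \sum_(b <- s) a.1 * conjc b.1 * cauchy_kernel a.2 (conjc b.2) t.
have -> : nform m s = b%:C * (S * conjc S) + CI F.
  rewrite /S rmorph_sum big_distrlr big_distrr /F complex_integral_sum; last first.
    move=> c cs; apply: cintegrable_sum => d ds; apply: cintegrableZ.
    exact: (CK (c, d)).
  rewrite -big_split; apply: eq_big_seq => c cs /=.
  rewrite complex_integral_sum; last first.
    by move=> d ds; apply: cintegrableZ; exact: (CK (c, d)).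
  rewrite big_distrr -big_split; apply: eq_big_seq => d ds /=.
  rewrite complex_integralZ; last exact: (CK (c, d)).
  by rewrite K ?(allP us) // mulrDr mulrC.
apply: addr_ge0; first by rewrite mulr_ge0 ?ler0c // mulcJ_ge0.
apply: complex_integral_ge0 => t.
have -> : F t = (\sum_(a <- s) a.1 * (t%:C - a.2)^-1) * conjc (\sum_(a <- s) a.1 * (t%:C - a.2)^-1).
  rewrite rmorph_sum big_distrlr; apply: eq_bigr => c _; apply: eq_bigr => d _ /=.
  rewrite conjM conjc_inv conjB conjc_real /cauchy_kernel; ring.
exact: mulcJ_ge0.
Qed.

(** * Expansions of Cauchy transforms from finite moments *)

Definition moment_finite k := (\int[rho]_(t in setT) (`|t| ^+ k)%:E < +oo)%E.

Lemma continuous_abs_exp k : continuous (fun t : R => `|t| ^+ k).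
Proof.
move=> t; apply: (@continuous_comp _ _ _ (fun u : R => `|u|) (fun u => u ^+ k)).
  exact: norm_continuous.
exact: exprn_continuous.
Qed.

Lemma moment_integrable k : moment_finite k ->
  rho.-integrable setT (EFin \o (fun t : R => `|t| ^+ k)).
Proof.
apply: ge0_integrable; first exact: continuous_abs_exp.
by move=> t; rewrite exprn_ge0.
Qed.

Definition cauchy_moment k z : R[i] := CI (fun t => t%:C ^+ k * (t%:C - z)^-1).

Lemma normc_subV_iy (t y : R) : 0 < y -> normc ((t%:C - iy y)^-1) <= y^-1.
Proof.
move=> y0; rewrite normcV lef_pV2 ?posrE //.
  apply: le_trans (normIm_le_normc _); rewrite /= sub0r normrN; exact: ler_norm.
by apply: (lt_le_trans y0); apply: le_trans (normIm_le_normc _); rewrite /= sub0r normrN; exact: ler_norm.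
Qed.

Lemma normc_cauchy_moment k (t y : R) : 0 < y ->
  normc (t%:C ^+ k * (t%:C - iy y)^-1) <= y^-1 * `|t| ^+ k.
Proof.
move=> y0; rewrite normcM normcX normc_real mulrC ler_wpM2r ?exprn_ge0 //.
exact: normc_subV_iy.
Qed.

Lemma nonreal_iy (y : R) : 0 < y -> nonreal (iy y).
Proof. by move=> y0; rewrite /nonreal /= gt_eqF. Qed.

Lemma ccont_cauchy_moment k z : nonreal z -> ccont (fun t => t%:C ^+ k * (t%:C - z)^-1).
Proof.
by move=> nz; apply: ccontM; [apply: ccontX; exact: ccont_id|exact: ccont_subV].
Qed.

Lemma moment_integrableZ k (c : R) : moment_finite k ->
  rho.-integrable setT (EFin \o (fun t : R => c * `|t| ^+ k)).
Proof.
by move=> /moment_integrable/(integrableZl measurableT c); apply: eq_integrable.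
Qed.

Lemma cintegrable_cauchy_moment k (y : R) : moment_finite k -> 0 < y ->
  cintegrable rho (fun t => t%:C ^+ k * (t%:C - iy y)^-1).
Proof.
move=> mk y0; apply: (@cintegrable_le _ _ _ (fun t => y^-1 * `|t| ^+ k)).
- by apply: ccont_cauchy_moment; exact: nonreal_iy.
- by move=> t; exact: normc_cauchy_moment.
- exact: moment_integrableZ.
Qed.

(** The identity z t^k / (t - z) = t^(k+1) / (t - z) - t^k, integrated; s is the k-th moment. *)
Lemma cauchy_momentS k : moment_finite k ->
  exists s : R, forall y, 0 < y ->
    cauchy_moment k (iy y) = (cauchy_moment k.+1 (iy y) - s%:C) / iy y.
Proof.
move=> mk; exists (Rintegral rho setT (fun t => t ^+ k)) => y y0.
have nz := nonreal_iy y0; have z0 := iy_neq0 y0.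
have it : cintegrable rho (fun t => t%:C ^+ k).
  apply: (@cintegrable_le _ _ _ (fun t => `|t| ^+ k)) (moment_integrable mk).
    by apply: ccontX; exact: ccont_id.
  by move=> t; rewrite normcX normc_real.
have -> : (Rintegral rho setT (fun t => t ^+ k))%:C = CI (fun t => t%:C ^+ k).
  rewrite /complex_integral; congr Complex.
    by apply: eq_Rintegral => t _; rewrite -rmorphXn.
  apply/esym; rewrite (@eq_Rintegral _ _ _ _ _ (fun=> 0)) /Rintegral ?integral0 // => t _.
  by rewrite -rmorphXn.
apply: (mulIf z0); rewrite divfK // /cauchy_moment.
apply/eqP; rewrite eq_sym subr_eq; apply/eqP.
rewrite mulrC -complex_integralZ; last exact: cintegrable_cauchy_moment.
rewrite -complex_integralD //; last by apply: cintegrableZ; exact: cintegrable_cauchy_moment.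
congr complex_integral; apply/funext => t.
have := sub_real_neq0 t nz => tz; rewrite exprS; field.
exact: tz.
Qed.

(** Each use of [cauchy_momentS] gains one order and raises k by one; the induction starts from the
    bound by 1/y times an absolute moment, up to a factor 2. *)
Lemma asym_cauchy_moment k n : (forall i, (i <= k + n)%N -> moment_finite i) ->
  asym n.+1 0 (fun y => cauchy_moment k (iy y)).
Proof.
elim: n k => [|n IH] k mk.
  apply: decay_asym; exists (2 * Rintegral rho setT (fun t => `|t| ^+ k)).
    by rewrite mulr_ge0 // Rintegral_ge0 // => t _; rewrite exprn_ge0.
  have m0 : moment_finite k by apply: mk; rewrite addn0.
  apply: filterS (@near_ge1 R) => y /(lt_le_trans ltr01) y0.
  have := @complex_integral_le _ rho _ (fun t => y^-1 * `|t| ^+ k)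
    (ccont_cauchy_moment k (nonreal_iy y0)) (fun t => normc_cauchy_moment k t y0)
    (moment_integrableZ _ m0).
  by rewrite RintegralZl //; [rewrite mulrCA mulrC expr1|exact: moment_integrable].
have m0 : moment_finite k by apply: mk; rewrite leq_addr.
have [s Hs] := cauchy_momentS m0.
have {}IH : asym n.+1 0 (fun y => cauchy_moment k.+1 (iy y)).
  by apply: IH => i; rewrite addSnnS; exact: mk.
have := asym_divz (asymD IH (asym_cst n.+1 (- s))).
by apply: asym_eq => y y0; rewrite Hs // rmorphN.
Qed.

Lemma moments_asym (m : R[i] -> R[i]) K : herglotz_measure m rho ->
  moments_upto rho (2 * K) ->
  exists (b c : R), 0 <= b /\
    asym (2 * K).+1 0 (fun y => m (iy y) - b%:C * iy y - c%:C).
Proof.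
move=> [fin [a [b [b0 mE]]]] mu.
(* Since the 0-th moment is finite, the term t / (1 + t^2) can be integrated on its own; its
   integral d goes into the constant, and the plain Cauchy transform of rho remains. *)
pose d := Rintegral rho setT (fun t => t / (1 + t ^+ 2)).
exists b, (a - d); split => //.
have aM : asym (2 * K).+1 0 (fun y => cauchy_moment 0 (iy y)) by exact: asym_cauchy_moment.
apply: asym_eq aM => y y0; have nz := nonreal_iy y0.
have m0 : moment_finite 0 by apply: mu.
have ir : cintegrable rho (fun t => (t / (1 + t ^+ 2))%:C).
  apply: (@cintegrable_le _ _ _ (fun t => `|t| ^+ 0)) (moment_integrable m0).
    split => t /=; last exact: cvg_cst.
    by apply: cvgM; [exact: cvg_id|exact: continuous_poisson].
  move=> t; rewrite normc_real expr0 normrM normfV.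
  have t1 : 0 < 1 + t ^+ 2 by rewrite ltr_pwDl // sqr_ge0.
  rewrite (gtr0_norm t1) ler_pdivrMr // mul1r -real_normK ?num_real //.
  set u := `|t|; have : 0 <= (u - 1) ^+ 2 by exact: sqr_ge0.
  have : 0 <= u by rewrite normr_ge0.
  nra.
have dE : d%:C = CI (fun t => (t / (1 + t ^+ 2))%:C).
  by rewrite /complex_integral; congr Complex; rewrite /Rintegral /= integral0.
have -> : cauchy_moment 0 (iy y) = CI (nevanlinna_kernel (iy y)) + d%:C.
  rewrite dE -complex_integralD //; last exact: cintegrable_nevanlinna.
  congr complex_integral; apply/funext => t.
  by rewrite expr0 mul1r /nevanlinna_kernel subrK.
by rewrite mE // /nevanlinna_kernel rmorphB; ring.
Qed.

End HerglotzMeasure.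

(** * From asymptotic expansions to moments *)

Section MomentsFromAsymptotics.
Variables (R : realType) (rho : {measure set (measurableTypeR R) -> \bar R}).
Implicit Types (k n : nat) (y t : R) (q : {poly R}).

Definition poisson_moment_fun k y t : R := t ^+ (2 * k) / (t ^+ 2 + y ^+ 2).

(** The function J_k of the overview; its integrand is even in y, hence the expansions below in
    powers of y^-2. *)
Definition poisson_moment k y : R := Rintegral rho setT (poisson_moment_fun k y).

Definition even_asym n (h : R -> R) := exists q, exists2 C : R, 0 <= C &
  \forall y \near +oo, `|h y - q.[(y^-1) ^+ 2]| <= C * ((y^-1) ^+ 2) ^+ n.

Lemma exprn_even_ge0 t k : 0 <= t ^+ (2 * k).
Proof. by rewrite exprM exprn_ge0 // sqr_ge0. Qed.

Lemma continuous_poisson_moment k y : 0 < y -> continuous (poisson_moment_fun k y).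
Proof.
move=> y0 t; apply: cvgM; first exact: exprn_continuous.
apply: cvgV; first by rewrite gt_eqF // ltr_wpDl ?sqr_ge0 // exprn_gt0.
by apply: cvgD; [exact: exprn_continuous|exact: cvg_cst].
Qed.

Lemma poisson_moment_ge0 k y t : 0 <= poisson_moment_fun k y t.
Proof. by rewrite divr_ge0 ?exprn_even_ge0 // addr_ge0 // sqr_ge0. Qed.

Lemma poisson_moment_le k y t : 1 <= y -> poisson_moment_fun k y t <= poisson_moment_fun k 1 t.
Proof.
move=> y1; rewrite ler_wpM2l ?exprn_even_ge0 //.
have t2 : 0 <= t ^+ 2 by exact: sqr_ge0.
rewrite lef_pV2 ?posrE ?ltr_wpDl ?exprn_gt0 ?(lt_le_trans ltr01) //.
by rewrite lerD2l ler_pXn2r ?nnegrE ?ler01 ?(le_trans ler01).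
Qed.

(** Integrability at y = 1 controls all y >= 1, where the integrand is smaller. *)
Definition poisson_moment_integrable k :=
  rho.-integrable setT (EFin \o (poisson_moment_fun k 1)).

Lemma poisson_moment_integrable_ge1 k y : poisson_moment_integrable k -> 1 <= y ->
  rho.-integrable setT (EFin \o (poisson_moment_fun k y)).
Proof.
move=> ik y1; apply: continuous_le_integrable ik.
  by apply: continuous_poisson_moment; exact: lt_le_trans y1.
by move=> t; rewrite ger0_norm ?poisson_moment_ge0 // poisson_moment_le.
Qed.

Lemma poly_bounded q : exists2 B : R, 0 <= B & forall x : R, `|x| <= 1 -> `|q.[x]| <= B.
Proof.
elim/poly_ind: q => [|q c [B B0 HB]].
  by exists 0 => // x _; rewrite horner0 normr0.
exists (B + `|c|); first by rewrite addr_ge0.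
move=> x x1; rewrite hornerMXaddC; apply: le_trans (ler_normD _ _) _.
by rewrite lerD2r normrM -[leRHS]mulr1 ler_pM // HB.
Qed.

Lemma near_pinfty_natS (P : R -> Prop) : (\forall y \near +oo, P y) ->
  \forall n \near \oo, P (n.+1%:R).
Proof.
move=> [M [_ HM]]; near=> n; apply: HM.
have : M <= n%:R by near: n; exact: nbhs_infty_ger.
by move=> /le_lt_trans; apply; rewrite ltr_nat.
Unshelve. all: by end_near. Qed.

Lemma invn_le1 n : 0 <= (n.+1%:R : R)^-1 <= 1.
Proof. by rewrite invr_ge0 ler0n invf_le1 ?ltr0n // ler1n. Qed.

(** Dominated convergence with the integrand at y = 1 as majorant, along y = n + 1 in order to have
    a sequence. *)
Lemma poisson_moment_cvg0 k : poisson_moment_integrable k ->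
  forall e : R, 0 < e -> \forall n \near \oo, poisson_moment k n.+1%:R <= e.
Proof.
move=> ik e e0.
have n1 n : (1 : R) <= n.+1%:R by rewrite ler1n.
pose f_ n t : \bar R := (poisson_moment_fun k n.+1%:R t)%:E.
have mf n : measurable_fun setT (f_ n : measurableTypeR R -> _).
  apply/measurable_EFinP; apply: continuous_measurable.
  by apply: continuous_poisson_moment; exact: lt_le_trans (n1 n).
have [] := @dominated_convergence _ _ _ rho setT measurableT f_ (cst 0%E)
  (EFin \o poisson_moment_fun k 1) mf (measurable_cst _) _ ik _.
- apply: aeW => t _; apply: cvg_EFin; first by apply: nearW.
  (* With h = 1/(n + 1), 1/(t^2 + (n + 1)^2) = h^2 / (1 + t^2 h^2), which is continuous at h = 0. *)
  have : (fun n => t ^+ (2 * k) * (harmonic n ^+ 2 / (1 + t ^+ 2 * harmonic n ^+ 2))) @ \oo -->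
      t ^+ (2 * k) * (0 ^+ 2 / (1 + t ^+ 2 * 0 ^+ 2)).
    have h2 : (fun n => (harmonic n : R) ^+ 2) @ \oo --> (0 : R) ^+ 2.
      exact: cvgM (@cvg_harmonic R) (@cvg_harmonic R).
    apply: cvgM; first exact: cvg_cst.
    apply: cvgM => //; apply: cvgV; first by rewrite expr0n mulr0 addr0 oner_eq0.
    by apply: cvgD; [exact: cvg_cst|apply: cvgM => //; exact: cvg_cst].
  have -> : t ^+ (2 * k) * (0 ^+ 2 / (1 + t ^+ 2 * 0 ^+ 2)) = 0 by rewrite expr0n mul0r mulr0.
  apply: cvg_trans; apply: near_eq_cvg; apply: nearW => n /=.
  rewrite /poisson_moment_fun /harmonic /=; congr (_ * _).
  have n0 : n.+1%:R != 0 :> R by rewrite pnatr_eq0.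
  have p0 : 0 < t ^+ 2 + n.+1%:R ^+ 2 :> R by rewrite ltr_wpDl ?sqr_ge0 // exprn_gt0 ?ltr0n.
  move: n0 p0; move: (n.+1%:R : R) => u n0 p0.
  by field; rewrite n0 andbT gt_eqF.
- apply: aeW => t n _; rewrite lee_fin ger0_norm ?poisson_moment_ge0 //.
  exact: poisson_moment_le.
move=> _ _; rewrite integral_cst // mul0e => /fine_cvgP[_ /cvgrPdist_le H].
have := H e e0; apply: filterS => n; rewrite sub0r normrN.
by apply: le_trans; rewrite ler_norm.
Qed.

Lemma near_nat_le (a b D : R) :
  (\forall n \near \oo, a <= b + D * (n.+1%:R)^-1) -> a <= b.
Proof.
move=> H; rewrite -[b]addr0.
have c : (fun n => b + D * harmonic n) @ \oo --> b + D * 0.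
  by apply: cvgD; [exact: cvg_cst|apply: cvgM; [exact: cvg_cst|exact: cvg_harmonic]].
rewrite mulr0 in c; rewrite -(cvg_lim _ c) //.
apply: limr_ge; first by apply/cvg_ex; exists (b + 0).
exact: H.
Qed.

Lemma even_asym_root0 k n q (C : R) : 0 <= C -> poisson_moment_integrable k ->
  (\forall y \near +oo,
    `|poisson_moment k y - q.[(y^-1) ^+ 2]| <= C * ((y^-1) ^+ 2) ^+ n.+1) ->
  q.[0] = 0.
Proof.
move=> C0 ik /near_pinfty_natS H.
have [s es] : exists s, q - q.[0]%:P = s * 'X.
  by apply: poly_root0; rewrite hornerD hornerN hornerC subrr.
have [B B0 HB] := poly_bounded s.
apply/eqP; rewrite -normr_le0 -(addr0 0); apply/ler_addgt0Pr => e e0; rewrite addr0 add0r.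
(* With x = 1/(i + 1), |q(0)| <= J_k + C x^(2(n+1)) + |q(x^2) - q(0)|; the last two terms are at
   most (C + B) x as x <= 1, and J_k is eventually below e. *)
apply: (@near_nat_le _ _ (C + B)); near=> i.
have /andP[x0 x1] := invn_le1 i; set x := _^-1 in x0 x1 *.
have x2 : 0 <= x ^+ 2 by exact: sqr_ge0.
have x21 : x ^+ 2 <= x by rewrite expr2 ler_piMr.
have x2le1 : x ^+ 2 <= 1 by exact: le_trans x21 x1.
have J1 : poisson_moment k i.+1%:R <= e by near: i; exact: poisson_moment_cvg0.
have J2 : `|poisson_moment k i.+1%:R - q.[x ^+ 2]| <= C * (x ^+ 2) ^+ n.+1.
  by rewrite /x; near: i; exact: H.
have J0 : 0 <= poisson_moment k i.+1%:R.
  by apply: Rintegral_ge0 => t _; exact: poisson_moment_ge0.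
have qE : q.[x ^+ 2] - q.[0] = s.[x ^+ 2] * x ^+ 2.
  have := congr1 (fun u => u.[x ^+ 2]) es.
  by rewrite hornerD hornerN hornerC hornerMX.
have J3 : `|s.[x ^+ 2] * x ^+ 2| <= B * x.
  rewrite normrM ler_pM // ?(ger0_norm x2) // HB // ger0_norm //.
have J4 : C * (x ^+ 2) ^+ n.+1 <= C * x.
  rewrite ler_wpM2l // exprS; apply: le_trans x21.
  by rewrite ler_piMr // exprn_ile1.
move: J2 J3; rewrite -qE !ler_norml => /andP[a1 a2] /andP[b1 b2].
by rewrite mulrDl; apply/andP; split; lra.
Unshelve. all: by end_near. Qed.

(** y^2 t^(2k) / (t^2 + y^2) increases to t^(2k) as y grows, so by monotone convergence the bound B
    passes to the moment. *)
Lemma poisson_moment_bounded k (B : R) : poisson_moment_integrable k ->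
  (\forall y \near +oo, y ^+ 2 * poisson_moment k y <= B) -> moment_finite rho (2 * k).
Proof.
move=> ik /near_pinfty_natS H.
have n1 n : (1 : R) <= n.+1%:R by rewrite ler1n.
have n0 n : (0 : R) < n.+1%:R by rewrite ltr0n.
pose g n t : \bar R := (n.+1%:R ^+ 2 * poisson_moment_fun k n.+1%:R t)%:E.
have gE n t : n.+1%:R ^+ 2 * poisson_moment_fun k n.+1%:R t =
    t ^+ (2 * k) * (1 + t ^+ 2 * harmonic n ^+ 2)^-1.
  rewrite /poisson_moment_fun /harmonic /= mulrCA; congr (_ * _).
  have p0 : 0 < t ^+ 2 + n.+1%:R ^+ 2 :> R by rewrite ltr_wpDl ?sqr_ge0 // exprn_gt0.
  move: (n0 n) p0; move: (n.+1%:R : R) => u u0 p0.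
  have p1 : 0 < u ^+ 2 + t ^+ 2 by rewrite addrC.
  by field; rewrite ?(gt_eqF u0) ?(gt_eqF p0) ?(gt_eqF p1).
have mg n : measurable_fun setT (g n : measurableTypeR R -> _).
  apply/measurable_EFinP; apply: continuous_measurable => t; apply: cvgM.
    exact: cvg_cst.
  by apply: continuous_poisson_moment.
have g0 n t : setT t -> (0 <= g n t)%E.
  by move=> _; rewrite lee_fin mulr_ge0 ?poisson_moment_ge0 // sqr_ge0.
have pos t (h : R) : 0 < 1 + t ^+ 2 * h ^+ 2 by rewrite ltr_pwDl // mulr_ge0 ?sqr_ge0.
have ndg t : setT t -> {homo g^~ t : n m / (n <= m)%N >-> (n <= m)%E}.
  move=> _ i j ij; rewrite lee_fin !gE ler_wpM2l ?exprn_even_ge0 //.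
  rewrite lef_pV2 ?posrE // lerD2l ler_wpM2l ?sqr_ge0 //.
  rewrite ler_pXn2r // ?nnegrE ?harmonic_ge0 // lef_pV2 ?posrE //.
  by rewrite ler_nat.
have lim_g t : limn (g^~ t) = (`|t| ^+ (2 * k))%:E.
  have -> : `|t| ^+ (2 * k) = t ^+ (2 * k) by rewrite -normrX ger0_norm // exprn_even_ge0.
  apply/cvg_lim => //; apply: cvg_EFin; first exact: nearW.
  have : (fun n => t ^+ (2 * k) * (1 + t ^+ 2 * harmonic n ^+ 2)^-1) @ \oo -->
      t ^+ (2 * k) * (1 + t ^+ 2 * 0 ^+ 2)^-1.
    have h2 : (fun n => (harmonic n : R) ^+ 2) @ \oo --> (0 : R) ^+ 2.
      exact: cvgM (@cvg_harmonic R) (@cvg_harmonic R).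
    apply: cvgM; first exact: cvg_cst.
    apply: cvgV; first by rewrite expr0n mulr0 addr0 oner_eq0.
    by apply: cvgD; [exact: cvg_cst|apply: cvgM => //; exact: cvg_cst].
  rewrite expr0n mulr0 addr0 invr1 mulr1.
  by apply: cvg_trans; apply: near_eq_cvg; apply: nearW => n /=; rewrite gE.
have cvg_g := @cvg_monotone_convergence _ _ _ rho setT measurableT g mg g0 ndg.
rewrite /moment_finite.
have <- : (\int[rho]_(t in setT) limn (g^~ t) = \int[rho]_(t in setT) (`|t| ^+ (2 * k))%:E)%E.
  by apply: eq_integral => t _; rewrite lim_g.
apply: (@le_lt_trans _ _ B%:E); last exact: ltry.
rewrite -(cvg_lim _ cvg_g) //; apply: lime_le; first by apply/cvg_ex; eexists; exact: cvg_g.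
apply: filterS H => n Hn.
have ikn := poisson_moment_integrable_ge1 ik (n1 n).
have -> : (\int[rho]_(t in setT) g n t =
   (n.+1%:R ^+ 2)%:E * \int[rho]_(t in setT) (poisson_moment_fun k n.+1%:R t)%:E)%E.
  by rewrite -integralZl.
by rewrite -(fineK (integrable_fin_num measurableT ikn)) -EFinM lee_fin.
Qed.

(** Dividing q by X turns the expansion of J_k into one of y^2 J_k, which is therefore bounded and
    gives the moment; J_(k+1) is that moment minus y^2 J_k, with one order in y^-2 less. *)
Lemma even_asym_step k n : poisson_moment_integrable k ->
  even_asym n.+1 (poisson_moment k) ->
  [/\ moment_finite rho (2 * k), poisson_moment_integrable k.+1 &
      even_asym n (poisson_moment k.+1)].
Proof.
move=> ik [q [C C0 HC]].
have [s es] := poly_root0 (even_asym_root0 C0 ik HC).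
have E y : 1 <= y ->
    y ^+ 2 * poisson_moment k y - s.[(y^-1) ^+ 2] =
    y ^+ 2 * (poisson_moment k y - q.[(y^-1) ^+ 2]).
  move=> y1; rewrite es hornerMX mulrBr; congr (_ - _).
  have y0 : y != 0 by rewrite gt_eqF // (lt_le_trans ltr01).
  by rewrite exprVn mulrCA mulrV ?mulr1 // unitfE expf_neq0.
have asq : \forall y \near +oo,
    `|y ^+ 2 * poisson_moment k y - s.[(y^-1) ^+ 2]| <= C * ((y^-1) ^+ 2) ^+ n.
  apply: filterS2 HC (@near_ge1 R) => y Hy y1; rewrite E // normrM ger0_norm ?sqr_ge0 //.
  have y0 : 0 < y by exact: lt_le_trans y1.
  rewrite -ler_pdivlMl ?exprn_gt0 // mulrCA -exprVn -exprS //.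
have mk : moment_finite rho (2 * k).
  have [B B0 HB] := poly_bounded s.
  apply: (@poisson_moment_bounded k (B + C)) => //.
  apply: filterS2 asq (@near_ge1 R) => y Hy y1.
  have y0 : 0 < y by exact: lt_le_trans y1.
  have x0 : 0 <= y^-1 ^+ 2 by exact: sqr_ge0.
  have x1 : y^-1 ^+ 2 <= 1 by rewrite exprn_ile1 ?invr_ge0 ?(ltW y0) // invf_le1.
  have Cn : C * (y^-1 ^+ 2) ^+ n <= C by rewrite ler_piMr // exprn_ile1.
  have sB := HB (y^-1 ^+ 2) ltac:(by rewrite ger0_norm).
  move: Hy sB; rewrite !ler_norml => /andP[_ H1] /andP[_ H2]; lra.
have imk := moment_integrable mk.
have absE t : `|t| ^+ (2 * k) = t ^+ (2 * k) by rewrite -normrX ger0_norm // exprn_even_ge0.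
have pS y t : 0 < y -> poisson_moment_fun k.+1 y t =
    `|t| ^+ (2 * k) - y ^+ 2 * poisson_moment_fun k y t.
  move=> y0; rewrite absE /poisson_moment_fun mulnS exprD.
  by field; rewrite gt_eqF // ltr_wpDl ?sqr_ge0 // exprn_gt0.
have ikS : poisson_moment_integrable k.+1.
  apply: continuous_le_integrable imk; first exact: continuous_poisson_moment.
  move=> t; rewrite ger0_norm ?poisson_moment_ge0 // pS //.
  by rewrite gerBl mulr_ge0 ?sqr_ge0 ?poisson_moment_ge0.
split => //.
exists ((Rintegral rho setT (fun t => `|t| ^+ (2 * k)))%:P - s), C => //.
apply: filterS2 asq (@near_ge1 R) => y Hy y1.
have y0 : 0 < y by exact: lt_le_trans y1.
have ikn := poisson_moment_integrable_ge1 ik y1.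
have -> : poisson_moment k.+1 y = Rintegral rho setT (fun t => `|t| ^+ (2 * k)) -
    y ^+ 2 * poisson_moment k y.
  rewrite /poisson_moment -RintegralZl // -RintegralB //.
    by apply: eq_Rintegral => t _; exact: pS.
  by have := integrableZl measurableT (y ^+ 2) ikn; apply: eq_integrable.
rewrite hornerD hornerN hornerC.
by rewrite -normrN; apply: le_trans Hy; rewrite le_eqVlt; apply/orP; left; apply/eqP; congr (`|_|); ring.
Qed.

(** As 1/(iy) = -i/y, even powers are real and odd ones imaginary when the coefficients are real;
    [qe] and [qo] carry these two parts, signs included. *)
Lemma horner_iyV (p : {poly R}) : exists qe qo : {poly R}, forall y,
  (map_poly (real_complex R) p).[(iy y)^-1] = qe.[(y^-1) ^+ 2] +i* (qo.[(y^-1) ^+ 2] * y^-1).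
Proof.
elim/poly_ind: p => [|p c [qe [qo H]]].
  by exists 0, 0 => y; rewrite rmorph0 !horner0 mul0r.
exists (qo * 'X + c%:P), (- qe) => y.
have -> : map_poly (real_complex R) (p * 'X + c%:P) = map_poly (real_complex R) p * 'X + c%:C%:P.
  by rewrite rmorphD rmorphM /= map_polyX map_polyC.
rewrite hornerMXaddC H.
have -> : (iy y)^-1 = 0 +i* (- y^-1).
  rewrite /iy; apply/eqP; rewrite eq_complex /= expr0n add0r mul0r eqxx /=.
  have [->|y0] := eqVneq y 0; first by rewrite expr0n invr0 mulr0 eqxx.
  by apply/eqP; field.
rewrite hornerD hornerMX hornerC hornerN.
apply/eqP; rewrite eq_complex /=; apply/andP; split; apply/eqP; ring.
Qed.

(** Only the odd powers contribute to the imaginary part, and division by y makes them even; the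
    error O(y^-(2K+1)) becomes O(y^-(2K+2)), which is order K + 1 in y^-2. *)
Lemma asym_even_asym K c (g : R -> R[i]) : asym (2 * K).+1 c g ->
  even_asym K.+1 (fun y => complex.Im (g y) / y).
Proof.
move=> [p _ [C C0 HC]]; have [qe [qo H]] := horner_iyV p.
exists (qo * 'X), C => //.
apply: filterS2 HC (@near_ge1 R) => y Hy y1.
have y0 : 0 < y by exact: lt_le_trans y1.
have -> : complex.Im (g y) / y - (qo * 'X).[y^-1 ^+ 2] =
   complex.Im (g y - (map_poly (real_complex R) p).[(iy y)^-1]) / y.
  rewrite H ImD ImN /= hornerMX; field; by rewrite gt_eqF.
rewrite normrM [`|y^-1|]ger0_norm ?invr_ge0 ?(ltW y0) //.
apply: (@le_trans _ _ (C / y ^+ (2 * K).+1 / y)).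
  by rewrite ler_pM2r ?invr_gt0 // (le_trans (normIm_le_normc _)).
by rewrite -exprM mulnS -exprVn -mulrA -exprSr.
Qed.

Lemma even_asym_moments K : poisson_finite rho -> even_asym K.+1 (poisson_moment 0) ->
  moments_upto rho (2 * K).
Proof.
move=> fin h0.
have i0 : poisson_moment_integrable 0.
  have := poisson_integrable 1 fin; apply: eq_integrable => // t _ /=.
  by rewrite /poisson_moment_fun muln0 expr0 expr1n addrC.
(* Every step costs one order, so the K + 1 orders at k = 0 leave one at k = K, enough for the
   moment of order 2K. *)
have H k : (k <= K)%N -> poisson_moment_integrable k /\ even_asym (K - k).+1 (poisson_moment k).
  elim: k => [|k IH] kK; first by rewrite subn0.
  have [ik ek] := IH (ltnW kK).
  have [_ ikS ekS] := even_asym_step ik ek; split => //.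
  by rewrite subnSK.
have M k : (k <= K)%N -> moment_finite rho (2 * k).
  by move=> /H[ik ek]; have [] := even_asym_step ik ek.
move=> i iK.
have I0 := moment_integrable (M 0%N (leq0n K)); have IK := moment_integrable (M K (leqnn K)).
have : rho.-integrable setT (EFin \o (fun t : R => `|t| ^+ i)).
  (* Odd and intermediate moments follow from |t|^i <= 1 + |t|^(2K). *)
  have I2 : rho.-integrable setT (EFin \o (fun t : R => `|t| ^+ (2 * 0) + `|t| ^+ (2 * K))).
    by have := integrableD measurableT I0 IK; apply: eq_integrable.
  apply: continuous_le_integrable I2; first exact: continuous_abs_exp.
  move=> t; rewrite ger0_norm ?exprn_ge0 // muln0 expr0.
  have [t1|t1] := leP `|t| 1.
    by apply: le_trans (exprn_ile1 _ (normr_ge0 t) t1) _; rewrite lerDl exprn_ge0.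
  by apply: (@le_trans _ _ (`|t| ^+ (2 * K))); rewrite ?lerDr // ler_weXn2l // ltW.
exact: integrable_lty.
Qed.

(** Im m(iy) / y = b + J_0(y). As u is not assumed equal to b, the difference [u - b] enters the
    constant term of the expansion of J_0. *)
Lemma asym_moments (m : R[i] -> R[i]) (u w : R) K : herglotz_measure m rho ->
  asym (2 * K).+1 0 (fun y => m (iy y) - u%:C * iy y - w%:C) ->
  moments_upto rho (2 * K).
Proof.
move=> [fin [a [b [b0 mE]]]] /asym_even_asym[q [C C0 HC]].
apply: even_asym_moments => //; exists (q + (u - b)%:P), C => //.
apply: filterS2 HC (@near_ge1 R) => y Hy y1; apply: le_trans Hy.
have y0 : 0 < y by exact: lt_le_trans y1.
have -> : complex.Im (m (iy y) - u%:C * iy y - w%:C) / y =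
    (b - u) + poisson_moment 0 y.
  have ImCI : complex.Im (complex_integral rho (nevanlinna_kernel (iy y))) = y * poisson_moment 0 y.
    rewrite /= /poisson_moment -RintegralZl //; last first.
      apply: poisson_moment_integrable_ge1 => //.
      have := poisson_integrable 1 fin; apply: eq_integrable => // t _ /=.
      by rewrite /poisson_moment_fun muln0 expr0 expr1n addrC.
    apply: eq_Rintegral => t _; rewrite /poisson_moment_fun /nevanlinna_kernel muln0 expr0.
    by rewrite sub0r !subr0 sqrrN mulNr opprK mul1r.
  rewrite (mE _ (nonreal_iy y0)) !ImD !ImN !Im_realM ImCI /=; field.
  by rewrite gt_eqF.
by rewrite hornerD hornerC le_eqVlt; apply/orP; left; apply/eqP; congr (`|_|); ring.
Qed.

End MomentsFromAsymptotics.

(** * The equivalence of finite moments and the continued fraction *)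

Theorem theorem1p6 (R : realType) (m : R[i] -> R[i])
    (rho : {measure set (measurableTypeR R) -> \bar R}) (K : nat)
    (hm : herglotz_nevanlinna m)
    (hrat : ~ rational_off_real m)
    (hrho : herglotz_measure m rho) :
  moments_upto rho (2 * K)%N <->
  exists (mt : R[i] -> R[i]) (N : nat) (upsilon omega l : nat -> R),
    herglotz_nevanlinna mt /\
    (1 <= N)%N /\
    (forall n : nat, (n <= N)%N -> 0 <= upsilon n) /\
    (forall n : nat, (1 <= n <= N)%N -> 0 < l n) /\
    (forall n : nat, (1 <= n <= N.-1)%N -> 0 < upsilon n + `|omega n|) /\
    (K <= N.-1 + count (fun n => (upsilon n != 0)%R) (iota 1 N))%N /\
    (forall z : R[i], nonreal z ->
       m z = contfrac upsilon omega l z (mt z) 0 N).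
Proof.
split.
  move=> /(moments_asym hrho)[b [c [b0 am]]].
  have pm := herglotz_pick hm hrho.
  have pf := pick_sub_lin pm (asym_decay0 am).
  apply: (@tail_expansion_full _ K m (fun z => m z - b%:C * z - c%:C) b c) => //.
    apply: pick_tail_expansion pf _ am => -[p [q pq]]; apply: hrat.
    (* A rational remainder p/q would make m = p/q + b z + c rational. *)
    exists (p + (b%:C *: 'X + c%:C%:P) * q), q => z nz; have [q0 E] := pq z nz.
    split; first exact: q0.
    rewrite hornerD hornerM hornerD hornerZ hornerX hornerC mulrDl mulfK // -E.
    by ring.
  by move=> z _; ring.
move=> [mt [[|d] [up [om [l [[_ mt0 _] [N1 [up0 [l0 [uo [Kd mE]]]]]]]]]]] //.
(* N = d + 1: below the outermost level lies a tail starting at index 1, whose order is governed by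
   N - 1 plus the count of nonzero upsilon. *)
have aM : asym (2 * (d + count (fun n => up n != 0) (iota 1 d.+1))).+1 0
   (fun y => (- (l 1%N)%:C * iy y + (contfrac up om l (iy y) (mt (iy y)) 1 d)^-1)^-1).
  by apply: asym_contfrac_tail => // i /andP[_ id]; exact: up0.
apply: (@asym_moments _ rho m (up 0%N) (om 0%N)) => //.
apply: (@asym_le _ _ (2 * (d + count (fun n => up n != 0) (iota 1 d.+1))).+1).
  by rewrite ltnS leq_mul2l.
apply: asym_eq aM => y /nonreal_iy ny; rewrite mE //= ; ring.
Qed.
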